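(* Let $(M,g,\upsilon^3)$ be a pseudo-quaternion Kähler manifold with $\dim M=4n\geq 8$, admitting a strongly degenerate homogeneous pseudo-quaternion Kähler structure of linear type. Then $(M,g,\upsilon^3)$ is flat.
   Context: A pseudo-quaternionic Hermitian structure on a pseudo-Riemannian manifold $(M,g)$ is a rank-$3$ subbundle $\upsilon^3\subset\mathfrak{so}(TM)$ (skew-symmetric endomorphisms of $TM$) with local bases $J_1,J_2,J_3$ satisfying $J_1^2=J_2^2=J_3^2=-1$, $J_1J_2=J_3$. $(M,g,\upsilon^3)$ is pseudo-quaternion Kähler if $\upsilon^3$ is parallel with respect to the Levi-Civita connection $\nabla$ (equivalently, the holonomy group is contained in $Sp(p,q)Sp(1)$). With $\omega_a=g(\cdot,J_a\cdot)$, the form $\Omega=\omega_1\wedge\omega_1+\omega_2\wedge\omega_2+\omega_3\wedge\omega_3$ is globally defined. A homogeneous pseudo-quaternion Kähler structure is a $(1,2)$-tensor field $S$ such that $\widetilde\nabla=\nabla-S$ satisfies $\widetilde\nabla g=0$, $\widetilde\nabla R=0$, $\widetilde\nabla S=0$, $\widetilde\nabla\Omega=0$, where $R$ is the curvature tensor of $\nabla$. It is of linear type if locally $$S_XY=g(X,Y)\xi-g(Y,\xi)X+\sum_{a=1}^3\left(g(J_aY,\xi)J_aX-g(X,J_aY)J_a\xi\right)+\sum_{a=1}^3g(X,\zeta^a)J_aY$$ for vector fields $\xi,\zeta^a$, $a=1,2,3$. It is strongly degenerate if $\xi\neq0$ (nowhere vanishing; on a connected manifold this is equivalent to $\xi\not\equiv0$),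 $g(\xi,\xi)=0$ and $\zeta^a=0$ for $a=1,2,3$. *)

(* Defs.v *)
From HB Require Import structures.
From mathcomp Require Import all_boot all_order all_algebra.
From mathcomp Require Import all_classical all_reals all_analysis.

Set Implicit Arguments.
Unset Strict Implicit.
Unset Printing Implicit Defensive.

Import Order.TTheory GRing.Theory Num.Theory.
Import numFieldNormedType.Exports.

Local Open Scope classical_set_scope.
Local Open Scope ring_scope.

(* Only meaningful for open O: 'D_v f x and differentiability at x look at f
   on a full neighbourhood of x. *)
Fixpoint Ck_on (R : realType) (U V : normedModType R) (k : nat)
    (O : set U) (f : U -> V) : Prop :=
  match k with
  | 0%N => forall x, O x -> {for x, continuous f}
  | k'.+1 => (forall x, O x -> differentiable f x) /\
             (forall v, Ck_on k' O (fun x => 'D_v f x))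
  end.

Definition smooth_on (R : realType) (U V : normedModType R)
    (O : set U) (f : U -> V) : Prop :=
  forall k, Ck_on k O f.

(* coord c and coordV c are total functions, but are only constrained on the
   chart domain dom c and on its image in R^m respectively. *)
Record manifold (R : realType) (m : nat) := Manifold {
  point :> topologicalType;
  point_hausdorff : hausdorff_space point;
  point_second_countable : @second_countable point;
  chart : Type;
  dom : chart -> set point;
  coord : chart -> point -> 'cV[R]_m;
  coordV : chart -> 'cV[R]_m -> point;
  dom_open : forall c, open (dom c);
  dom_cover : forall p, exists c, dom c p;
  cod_open : forall c, open (coord c @` dom c);
  coordK : forall c p, dom c p -> coordV c (coord c p) = p;
  coord_continuous : forall c p, dom c p -> {for p, continuous (coord c)};
  coordV_continuous : forall c x, (coord c @` dom c) x ->
    {for x, continuous (coordV c)};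
  transition_smooth : forall c c',
    smooth_on (coord c @` (dom c `&` dom c')) (coord c' \o coordV c)
}.

Section LocalCalculus.
Variables (R : realType) (m : nat).
Local Notation E := 'cV[R]_m.
Local Notation End := 'M[R]_m.

(* All objects of this section live on an open subset of the coordinate space
   R^m.  Endomorphisms act on column vectors on the left. *)

Definition pairing (B : 'M[R]_m) (u v : E) : R := (u^T *m B *m v) 0 0.

(* Sylvester normal form with s negative signs *)
Definition has_index (s : nat) (B : 'M[R]_m) : Prop :=
  exists2 P : 'M[R]_m, P \in unitmx &
    P^T *m B *m P = diag_mx (\row_i (-1) ^+ (i < s)%N).

(* A linear connection is given by its connection form C, so that
   (nabla_u Y)(x) = 'D_u Y x + C x u *m Y x.  For the Levi-Civita connection of
   the metric G, the l-th component of G x *m (C x u *m v) is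
   ((D_u g)(v, e_l) + (D_v g)(u, e_l) - (D_(e_l) g)(u, v)) / 2. *)
Definition levi_civita (G : E -> 'M[R]_m) (x u : E) : End :=
  2^-1 *: (invmx (G x) *m
    \matrix_(l, j) (('D_u G x) l j
                    + ('D_(delta_mx j 0) G x *m u) l 0
                    - ('D_(delta_mx l 0) G x *m u) j 0)).

Section Connection.
Variable C : E -> E -> End.

(* R(u, v) = nabla_u nabla_v - nabla_v nabla_u on constant coordinate fields,
   whose Lie bracket vanishes *)
Definition curvature (x u v : E) : End :=
  'D_u (fun y => C y v) x - 'D_v (fun y => C y u) x
  + C x u *m C x v - C x v *m C x u.

(* Covariant derivatives nabla_u at x, by the Leibniz rule, of: a bilinear
   form, an endomorphism field, an endomorphism-valued 1-form, an
   endomorphism-valued 2-tensor and a covariant 4-tensor; the arguments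
   v, v1, .., v4 are constant coordinate fields. *)
Definition nabla_bilin (B : E -> 'M[R]_m) (u x : E) : 'M[R]_m :=
  'D_u B x - (C x u)^T *m B x - B x *m C x u.

Definition nabla_end (A : E -> End) (u x : E) : End :=
  'D_u A x + C x u *m A x - A x *m C x u.

Definition nabla_end1 (S : E -> E -> End) (u x v : E) : End :=
  nabla_end (fun y => S y v) u x - S x (C x u *m v).

Definition nabla_end2 (K : E -> E -> E -> End) (u x v1 v2 : E) : End :=
  nabla_end (fun y => K y v1 v2) u x
  - K x (C x u *m v1) v2 - K x v1 (C x u *m v2).

Definition nabla_form4 (W : E -> E -> E -> E -> E -> R)
    (u x v1 v2 v3 v4 : E) : R :=
  'D_u (fun y => W y v1 v2 v3 v4 : R^o) x
  - W x (C x u *m v1) v2 v3 v4 - W x v1 (C x u *m v2) v3 v4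
  - W x v1 v2 (C x u *m v3) v4 - W x v1 v2 v3 (C x u *m v4).

End Connection.

Definition quaternionic (J : 'I_3 -> End) : Prop :=
  (forall a, J a *m J a = - 1%:M) /\ J 0 *m J 1 = J 2.

Definition span3 (J : 'I_3 -> End) : set End :=
  [set A | exists t : 'I_3 -> R, A = \sum_a t a *: J a].

Definition omega (B : 'M[R]_m) (A : End) (u v : E) : R := pairing B u (A *m v).

(* Wedge product of 2-forms, as the sum over (2,2)-shuffles without factor *)
Definition wedge22 (al be : E -> E -> R) (v1 v2 v3 v4 : E) : R :=
  al v1 v2 * be v3 v4 - al v1 v3 * be v2 v4 + al v1 v4 * be v2 v3
  + al v2 v3 * be v1 v4 - al v2 v4 * be v1 v3 + al v3 v4 * be v1 v2.

Definition fundamental_form (B : 'M[R]_m) (J : 'I_3 -> End)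
    (v1 v2 v3 v4 : E) : R :=
  \sum_a wedge22 (omega B (J a)) (omega B (J a)) v1 v2 v3 v4.

(* The right-hand side of the formula for S_X Y, with X = u and Y = v *)
Definition linear_type_rhs (B : 'M[R]_m) (J : 'I_3 -> End) (xi : E)
    (zeta : 'I_3 -> E) (u v : E) : E :=
  pairing B u v *: xi - pairing B v xi *: u
  + \sum_a (pairing B (J a *m v) xi *: (J a *m u)
            - pairing B u (J a *m v) *: (J a *m xi))
  + \sum_a pairing B u (zeta a) *: (J a *m v).

End LocalCalculus.

Section OnManifold.
Variables (R : realType) (m : nat) (M : manifold R m).
Local Notation E := 'cV[R]_m.
Local Notation End := 'M[R]_m.

Definition cod (c : chart M) : set E := coord c @` dom c.

Definition overlap (c c' : chart M) : set E := coord c @` (dom c `&` dom c').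

Definition transition (c c' : chart M) : E -> E := coord c' \o coordV c.

(* A tensor field on M is a family, indexed by the charts, of fields on the
   images of the charts, which correspond to each other under the differentials
   of the transition maps. *)

Definition pseudo_riemannian (g : chart M -> E -> 'M[R]_m) : Prop :=
  [/\ forall c, smooth_on (cod c) (g c),
      forall c x, cod c x -> (g c x)^T = g c x /\ g c x \in unitmx,
      exists s, forall c x, cod c x -> has_index s (g c x)
    & forall c c' x, overlap c c' x -> forall u v,
        pairing (g c x) u v =
        pairing (g c' (transition c c' x))
          ('d (transition c c') x u) ('d (transition c c') x v)].

Definition tensor12 (S : chart M -> E -> E -> End) : Prop :=
  [/\ forall c u, smooth_on (cod c) (fun x => S c x u),
      forall c x, cod c x -> forall (t : R) u v,
        S c x (t *: u + v) = t *: S c x u + S c x v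
    & forall c c' x, overlap c c' x -> forall u v,
        'd (transition c c') x (S c x u *m v) =
        S c' (transition c c' x) ('d (transition c c') x u)
          *m 'd (transition c c') x v].

Variable g : chart M -> E -> 'M[R]_m.

(* Q c x is the fibre of the subbundle at the point with coordinates x. *)
Variable Q : chart M -> E -> set End.

Definition local_frame (c : chart M) (V : set E) (J : 'I_3 -> E -> End) : Prop :=
  [/\ open V, V `<=` cod c, forall a, smooth_on V (J a)
    & forall x, V x ->
        quaternionic (fun a => J a x) /\ Q c x = span3 (fun a => J a x)].

(* The relations between the J_a make them linearly independent when m > 0, so
   that local frames do give a subbundle of rank 3. *)
Definition pseudo_quaternionic_hermitian : Prop :=
  [/\ pseudo_riemannian g,
      forall c x, cod c x -> forall A, Q c x A -> A^T *m g c x = - (g c x *m A),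
      forall c x, cod c x -> exists V J, V x /\ local_frame c V J
    & forall c c' x, overlap c c' x -> forall A A' : End,
        (forall u, 'd (transition c c') x (A *m u) =
                   A' *m 'd (transition c c') x u) ->
        (Q c x A <-> Q c' (transition c c' x) A')].

Definition nablaLC (c : chart M) : E -> E -> End := levi_civita (g c).

Definition parallel_subbundle : Prop :=
  forall c (V : set E) (A : E -> End), open V -> V `<=` cod c ->
    smooth_on V A -> (forall x, V x -> Q c x (A x)) ->
  forall x, V x -> forall u, Q c x (nabla_end (nablaLC c) A u x).

Definition pseudo_quaternion_kahler : Prop :=
  pseudo_quaternionic_hermitian /\ parallel_subbundle.

Definition nablaS (S : chart M -> E -> E -> End) (c : chart M) (x u : E) : End :=
  nablaLC c x u - S c x u.

(* On the domain of a local frame the globally defined 4-form Omega is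
   fundamental_form; it is parallel when all these local expressions are. *)
Definition homogeneous_pqk (S : chart M -> E -> E -> End) : Prop :=
  [/\ tensor12 S,
      forall c x, cod c x -> forall u, nabla_bilin (nablaS S c) (g c) u x = 0,
      forall c x, cod c x -> forall u v1 v2,
        nabla_end2 (nablaS S c) (curvature (nablaLC c)) u x v1 v2 = 0,
      forall c x, cod c x -> forall u v, nabla_end1 (nablaS S c) (S c) u x v = 0
    & forall c V J, local_frame c V J -> forall x, V x -> forall u v1 v2 v3 v4,
        nabla_form4 (nablaS S c)
          (fun y => fundamental_form (g c y) (fun a => J a y))
          u x v1 v2 v3 v4 = 0].

Definition linear_type_on (S : chart M -> E -> E -> End) (c : chart M)
    (V : set E) (J : 'I_3 -> E -> End) (xi : E -> E) (zeta : 'I_3 -> E -> E) :=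
  [/\ local_frame c V J, smooth_on V xi, forall a, smooth_on V (zeta a)
    & forall x, V x -> forall u v,
        S c x u *m v =
        linear_type_rhs (g c x) (fun a => J a x) (xi x) (fun a => zeta a x) u v].

Definition strongly_degenerate_linear_type (S : chart M -> E -> E -> End) : Prop :=
  forall c x, cod c x -> exists V J xi zeta,
    [/\ V x, linear_type_on S c V J xi zeta
      & forall y, V y ->
          [/\ xi y != 0, pairing (g c y) (xi y) (xi y) = 0
            & forall a, zeta a y = 0]].

Definition flat : Prop :=
  forall c x, cod c x -> forall u v, curvature (nablaLC c) x u v = 0.

End OnManifold.

(* Main.v *)
Require Import Defs.
From HB Require Import structures.
From mathcomp Require Import all_boot all_order all_algebra.
From mathcomp Require Import all_classical all_reals all_analysis.
From mathcomp Require Import ring lra.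
Set Implicit Arguments.
Unset Strict Implicit.
Unset Printing Implicit Defensive.
Import Order.TTheory GRing.Theory Num.Theory.
Import numFieldNormedType.Exports.
Local Open Scope classical_set_scope.
Local Open Scope ring_scope.

(** Everything is local and tensorial, so it suffices to work near a point of a
    chart, with a quaternionic frame J_1, J_2, J_3, the Levi-Civita connection
    form C and its curvature R.  Write <.,.> for the metric,
    th(X) = <X,xi> and th_a(X) = <X,J_a xi>.

    The structure determines xi: the trace of X -> S_X Y is -(m+2)<Y,xi>, where
    m is the dimension.  Since S and g are parallel for nabla~ = nabla - S, so
    is xi, which for null xi reads
      nabla_X xi = S_X xi = th(X) xi - sum_a th_a(X) J_a xi
    (lemmas nabla_xi and radial_S).  The parallel bundle of the J_a has a
    connection matrix that is antisymmetric in the frame J_a; with that, the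
    second covariant derivative of xi turns out to be symmetric, and the Ricci
    identity gives R_XY xi = 0 (lemma curvature_xi).

    As the bundle is parallel, [R_XY, J_a] is a combination of the J_b, given
    by three 2-forms al, be, ga (lemma curvature_commutator).  Pair symmetry
    turns R xi = 0 into a formula for R_(J_a xi, Z) in terms of these forms;
    the first Bianchi identity, and the commutation of R_(J_a xi, Z) with the
    frame, then kill al, be and ga (lemma ga_zero).  This is linear algebra in
    which xi null makes its quaternionic line totally isotropic.

    So R commutes with the J_a, and is killed by xi and the J_a xi in each
    slot.  Now nabla~ R = 0 expresses nabla R by R and S, and the second Bianchi
    identity becomes
      th(X) R_YZ + th(Y) R_ZX + th(Z) R_XY = 0
    (lemma theta_wedge_curvature).  This would leave the curvature of a plane
    wave, R = th ^ P for some P, but R_(JX,JY) = R_XY is incompatible with it: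
    if X0 has th(X0) = 1 and th_a(X0) = 0, the identity on J_2 X0 and J_3 X0
    gives R_(X0, J_1 X0) = 0, then on J_1 X0 and J_1 Z it gives R_(X0, Z) = 0,
    and finally R = 0 (lemma curvature_zero).

    The calculus that this rests on is the symmetry of second derivatives and the
    stability of C^k functions under sums, products and matrix inversion. *)

(** * Curvature tensors with a null vector in the kernel *)

Section QuaternionicCurvature.
Variables (F : realFieldType) (V : lmodType F) (ip : V -> V -> F).
Hypothesis ipC : forall u v, ip u v = ip v u.
Hypothesis ip_lin : forall a u v w, ip (a *: u + v) w = a * ip u w + ip v w.

(** All nine products and three skewness conditions are kept, so that the
    notion is visibly invariant under cyclic permutation of I, J, K: what is
    proved for one of them then holds for the others. *)
Record quaternion_triple (I J K : V -> V) : Prop := QuaternionTriple {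
  qII : forall u, I (I u) = - u; qJJ : forall u, J (J u) = - u;
  qKK : forall u, K (K u) = - u;
  qIJ : forall u, I (J u) = K u; qJK : forall u, J (K u) = I u;
  qKI : forall u, K (I u) = J u;
  qJI : forall u, J (I u) = - K u; qKJ : forall u, K (J u) = - I u;
  qIK : forall u, I (K u) = - J u;
  qI_skew : forall u v, ip (I u) v = - ip u (I v);
  qJ_skew : forall u v, ip (J u) v = - ip u (J v);
  qK_skew : forall u v, ip (K u) v = - ip u (K v) }.

Lemma quaternion_cycle I J K : quaternion_triple I J K -> quaternion_triple J K I.
Proof. by case. Qed.

Lemma ipDl u v w : ip (u + v) w = ip u w + ip v w.
Proof. by rewrite -[u in LHS]scale1r ip_lin mul1r. Qed.
Lemma ip0l w : ip 0 w = 0.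
Proof. by have := ipDl 0 0 w; rewrite addr0; lra. Qed.
Lemma ipZl a u w : ip (a *: u) w = a * ip u w.
Proof. by rewrite -[_ *: _]addr0 ip_lin ip0l addr0. Qed.
Lemma ipNl u w : ip (- u) w = - ip u w.
Proof. by rewrite -scaleN1r ipZl mulN1r. Qed.
Lemma ipDr u v w : ip w (u + v) = ip w u + ip w v.
Proof. by rewrite ipC ipDl !(ipC w). Qed.
Lemma ipZr a u w : ip w (a *: u) = a * ip w u.
Proof. by rewrite ipC ipZl ipC. Qed.

(** X0 pairs with xi, I xi, J xi, K xi as the first vector of a dual basis does;
    I X0, J X0, K X0 are then the other vectors of that dual basis. *)
Definition dual_to_line (xi X0 : V) (I J K : V -> V) :=
  [/\ ip xi X0 = 1, ip (I xi) X0 = 0, ip (J xi) X0 = 0 & ip (K xi) X0 = 0].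

Lemma dual_cycle xi X0 I J K : dual_to_line xi X0 I J K -> dual_to_line xi X0 J K I.
Proof. by case. Qed.

(** A quaternionic multiple of any w with <xi,w> <> 0 will do: the quaternion
    with components <xi,w>, <I xi,w>, <J xi,w>, <K xi,w> is nonzero, and w is
    multiplied by its inverse. *)
Lemma dual_exists I J K xi w : quaternion_triple I J K -> ip xi w != 0 ->
  exists X0, dual_to_line xi X0 I J K.
Proof.
move=> q w0; pose t0 := ip xi w.
pose t1 := ip (I xi) w; pose t2 := ip (J xi) w; pose t3 := ip (K xi) w.
pose N := t0 ^+ 2 + t1 ^+ 2 + t2 ^+ 2 + t3 ^+ 2.
have N0 : N != 0.
  have t00 : 0 < t0 ^+ 2 by rewrite exprn_even_gt0.
  have := sqr_ge0 t1; have := sqr_ge0 t2; have := sqr_ge0 t3.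
  rewrite /N => a b c; apply: lt0r_neq0; lra.
exists (N^-1 *: (t0 *: w + (- t1 *: I w + (- t2 *: J w + - t3 *: K w)))).
have skI u : ip u (I w) = - ip (I u) w by rewrite (qI_skew q) opprK.
have skJ u : ip u (J w) = - ip (J u) w by rewrite (qJ_skew q) opprK.
have skK u : ip u (K w) = - ip (K u) w by rewrite (qK_skew q) opprK.
have [z0 z1 z2 z3] :
  [/\ ip xi w = t0, ip (I xi) w = t1, ip (J xi) w = t2 & ip (K xi) w = t3] by [].
split; rewrite !(ipZr, ipDr, skI, skJ, skK)
  ?(qII q, qJJ q, qKK q, qIJ q, qJK q, qKI q, qJI q, qKJ q, qIK q) ?ipNl z0 z1 z2 z3; rewrite ?/N; field.
all: exact: N0.
Qed.

Variable k : V -> V -> V -> V -> F.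
Hypothesis k_anti12 : forall a b c d, k a b c d = - k b a c d.
Hypothesis k_anti34 : forall a b c d, k a b c d = - k a b d c.
Hypothesis k_bianchi : forall a b c d, k a b c d + k b c a d + k c a b d = 0.
Hypothesis k_lin3 : forall t a b c c' d,
  k a b (t *: c + c') d = t * k a b c d + k a b c' d.

(** Octahedron argument: combine the four Bianchi identities on the cyclic
    permutations of a, b, c, d. *)
Lemma pair_symmetry a b c d : k a b c d = k c d a b.
Proof.
have b1 := k_bianchi a b c d; have b2 := k_bianchi b c d a.
have b3 := k_bianchi c d a b; have b4 := k_bianchi d a b c.
have e1 := k_anti34 a b c d; have e2 := k_anti34 b c a d.
have e3 := k_anti34 c d a b; have e4 := k_anti34 d a b c.
have e5 : k c a b d = k a c d b by rewrite k_anti12 k_anti34 opprK.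
have e6 : k d b c a = k b d a c by rewrite k_anti12 k_anti34 opprK.
lra.
Qed.

Variables xi X0 : V.
Hypothesis xi_null : ip xi xi = 0.
Hypothesis k_xi : forall a b d, k a b xi d = 0.

(** When k a b c d = <R_ab c, d>, the three lines are the commutators
    [R_ab, I] = ga J - be K, [R_ab, J] = al K - ga I and
    [R_ab, K] = be I - al J, paired with c and d. *)
Definition sp1_part (I J K : V -> V) (al be ga : V -> V -> F) : Prop :=
  forall a b c d,
  [/\ k a b (I c) d + k a b c (I d) = ga a b * ip (J c) d - be a b * ip (K c) d,
      k a b (J c) d + k a b c (J d) = al a b * ip (K c) d - ga a b * ip (I c) d
    & k a b (K c) d + k a b c (K d) = be a b * ip (I c) d - al a b * ip (J c) d].

Lemma sp1_cycle I J K al be ga :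
  sp1_part I J K al be ga -> sp1_part J K I be ga al.
Proof. by move=> h a b c d; have [] := h a b c d. Qed.

Section OneIndex.
Variables (I J K : V -> V) (al be ga : V -> V -> F).
Hypothesis q : quaternion_triple I J K.
Hypothesis s : sp1_part I J K al be ga.
Hypothesis X0_dual : dual_to_line xi X0 I J K.

Let th1 := ip (I xi). Let th2 := ip (J xi). Let th3 := ip (K xi).

Lemma line_forms_on_frame :
  [/\ th1 (I X0) = 1, th2 (I X0) = 0 & th3 (I X0) = 0].
Proof.
have [e0 e1 e2 e3] := X0_dual; rewrite /th1 /th2 /th3.
have sk u : ip u (I X0) = - ip (I u) X0 by rewrite (qI_skew q) opprK.
by rewrite !sk (qII q) (qIJ q) (qIK q) !ipNl !opprK e0 e2 e3 oppr0.
Qed.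

Lemma curvature_on_Ixi a b d : k a b (I xi) d = ga a b * th2 d - be a b * th3 d.
Proof. by have [+ _ _] := s a b xi d; rewrite k_xi addr0. Qed.

(** Since <I xi,I xi> = <xi,xi> and I xi is orthogonal to xi by skewness, the
    quaternionic line of a null vector is totally isotropic. *)
Lemma line_isotropic :
  [/\ th1 xi = 0, th1 (I xi) = 0, th1 (J xi) = 0 & th1 (K xi) = 0].
Proof.
have sk u v : ip (I u) v = - ip u (I v) by rewrite (qI_skew q).
have z1 : ip (I xi) xi = 0 by have := sk xi xi; rewrite (ipC xi); lra.
have z2 : ip (J xi) xi = 0 by have := qJ_skew q xi xi; rewrite (ipC xi); lra.
have z3 : ip (K xi) xi = 0 by have := qK_skew q xi xi; rewrite (ipC xi); lra.
rewrite /th1; split=> //; rewrite sk ?(qII q) ?(qIJ q) ?(qIK q) ipC.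
- by rewrite ipNl xi_null !oppr0.
- by rewrite z3 oppr0.
- by rewrite ipNl z2 !oppr0.
Qed.

End OneIndex.

Section TwoForms.
Variables (I J K : V -> V) (al be ga : V -> V -> F).
Hypothesis q : quaternion_triple I J K.
Hypothesis s : sp1_part I J K al be ga.
Hypothesis X0_dual : dual_to_line xi X0 I J K.

Let th1 := ip (I xi). Let th2 := ip (J xi). Let th3 := ip (K xi).
Let X1 := I X0. Let X2 := J X0. Let X3 := K X0.

Let q2 := quaternion_cycle q.
Let q3 := quaternion_cycle q2.
Let d2 := dual_cycle X0_dual.
Let d3 := dual_cycle d2.
Let s2 := sp1_cycle s.
Let s3 := sp1_cycle s2.

Let forms_on_frame : [/\ th1 X1 = 1, th1 X2 = 0 & th1 X3 = 0] /\
          [/\ th2 X1 = 0, th2 X2 = 1 & th2 X3 = 0] /\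
          [/\ th3 X1 = 0, th3 X2 = 0 & th3 X3 = 1].
Proof.
have [] := line_forms_on_frame q X0_dual; have [] := line_forms_on_frame q2 d2.
by have [] := line_forms_on_frame q3 d3.
Qed.

Let forms_on_line : [/\ th1 (I xi) = 0, th1 (J xi) = 0 & th1 (K xi) = 0] /\
          [/\ th2 (I xi) = 0, th2 (J xi) = 0 & th2 (K xi) = 0] /\
          [/\ th3 (I xi) = 0, th3 (J xi) = 0 & th3 (K xi) = 0].
Proof.
have [] := line_isotropic q; have [] := line_isotropic q2.
by have [] := line_isotropic q3.
Qed.

(** This makes ga bilinear, although it is only given pointwise. *)
Lemma ga_as_curvature a b : ga a b = k a b (I xi) X2.
Proof.
have [_ [[_ t22 _] [_ t32 _]]] := forms_on_frame.
by rewrite (curvature_on_Ixi s) -/th2 -/th3 t22 t32; ring.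
Qed.

Lemma ga_lin t a a' b : ga (t *: a + a') b = t * ga a b + ga a' b.
Proof.
rewrite !ga_as_curvature pair_symmetry (k_anti12 _ _ _ b) (k_anti34 _ _ _ b) opprK.
by rewrite k_anti12 k_anti34 opprK k_lin3 -!(pair_symmetry _ _ (I xi)).
Qed.

Lemma curvature_along_Ixi x y z : k (I xi) z x y = ga x y * th2 z - be x y * th3 z.
Proof. by rewrite pair_symmetry (curvature_on_Ixi s). Qed.

(** The 3-form equality th2 ^ ga = th3 ^ be.  It is the first Bianchi identity
    with I xi in one slot, all three terms being known. *)
Lemma wedge_relation x y z :
  ga x y * th2 z - be x y * th3 z + (ga z x * th2 y - be z x * th3 y)
  - (ga z y * th2 x - be z y * th3 x) = 0.
Proof.
have := k_bianchi (I xi) z x y.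
rewrite curvature_along_Ixi (curvature_on_Ixi s) (k_anti12 x) curvature_along_Ixi.
rewrite -/th2 -/th3; lra.
Qed.

(** The curvature k (I xi) z (J xi) w can be computed from its first slot or from
    its third one. *)
Lemma mixed_relation z w :
  ga (J xi) w * th2 z - be (J xi) w * th3 z =
  al (I xi) z * th3 w - ga (I xi) z * th1 w.
Proof. by rewrite -curvature_along_Ixi (curvature_on_Ixi s2). Qed.

(** Evaluating the mixed relation on I X0, J X0, K X0 shows that the forms
    contracted with the line of xi are combinations of th1, th2, th3; the
    coefficients are then determined by finitely many values. *)
Lemma mixed_values z :
  [/\ ga (I xi) z = be (J xi) X1 * th3 z - ga (J xi) X1 * th2 z,
      al (I xi) z = ga (J xi) X3 * th2 z - be (J xi) X3 * th3 z,
      ga (J xi) z = al (I xi) X2 * th3 z - ga (I xi) X2 * th1 z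
    & be (J xi) z = ga (I xi) X3 * th1 z - al (I xi) X3 * th3 z].
Proof.
have [[t11 t12 t13] [[t21 t22 t23] [t31 t32 t33]]] := forms_on_frame.
have := mixed_relation z X1; have := mixed_relation z X3.
have := mixed_relation X2 z; have := mixed_relation X3 z.
rewrite t11 t13 t22 t32 t23 t33 t31.
by split; lra.
Qed.

Lemma ga_Jxi_zero : (forall z, ga (J xi) z = 0) /\ be (J xi) X1 = 0.
Proof.
have [[t11 t12 t13] [[t21 t22 t23] [t31 t32 t33]]] := forms_on_frame.
have [_ [[u21 u22 u23] [u31 u32 u33]]] := forms_on_line.
have W x y := wedge_relation x y (J xi).
have m := mixed_values.
have a2 : al (I xi) X2 = 0 /\ ga (I xi) X2 = 0.
  have [_ _ g2 b2] := m X2.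
  have [_ _ g3 b3] := m X3.
  have [_ _ g1 b1] := m X1.
  have := W X2 X1; have := W X2 X3.
  rewrite u22 u32 t22 t32 t23 t33 t21 t31 in g1 b1 g2 b2 g3 b3 *.
  by rewrite t12 t13 t11 in g1 b1 g2 b2 g3 b3; split; lra.
split=> [z|]; first by have [_ _ -> _] := m z; case: a2 => -> ->; ring.
have g3 : ga (J xi) X3 = 0 by have [_ _ -> _] := m X3; case: a2 => -> ->; ring.
have := W X1 X3.
rewrite u22 u32 t21 t31 t23 t33 g3; lra.
Qed.
End TwoForms.

(** The cyclic images of the preceding vanishing feed back into the mixed values
    and remove their remaining coefficients. *)
Lemma twist_Ixi_Jxi_zero I J K al be ga :
  quaternion_triple I J K -> sp1_part I J K al be ga ->
  dual_to_line xi X0 I J K ->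
  (forall z, be (J xi) z = 0) /\ (forall z, ga (I xi) z = 0 /\ al (I xi) z = 0).
Proof.
move=> q s d.
have q2 := quaternion_cycle q; have s2 := sp1_cycle s; have d2 := dual_cycle d.
have [gJ bJ1] := ga_Jxi_zero q s d.
have [aK _] := ga_Jxi_zero q2 s2 d2.
have bJ z : be (J xi) z = 0.
  have [t11 _ _] := line_forms_on_frame q d.
  have [_ -> _ _] := mixed_values q2 s2 d2 z.
  have [_ + _ _] := mixed_values q2 s2 d2 (I X0).
  by rewrite bJ1 !aK t11 mulr1 mul0r sub0r => /eqP; rewrite eq_sym oppr_eq0 => /eqP ->; ring.
split=> // z; have [-> -> _ _] := mixed_values q s d z.
by rewrite !bJ !gJ; split; ring.
Qed.

Lemma ga_line_zero I J K al be ga :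
  quaternion_triple I J K -> sp1_part I J K al be ga ->
  dual_to_line xi X0 I J K -> forall z,
  [/\ ga (I xi) z = 0, ga (J xi) z = 0 & ga (K xi) z = 0].
Proof.
move=> q s d z.
have q2 := quaternion_cycle q; have s2 := sp1_cycle s; have d2 := dual_cycle d.
have [_ /(_ z) [gI _]] := twist_Ixi_Jxi_zero q s d.
have [/(_ z) gK _] := twist_Ixi_Jxi_zero q2 s2 d2.
have [/(_ z) gJ _] := ga_Jxi_zero q s d.
by split.
Qed.

Section Vanishing.
Variables (I J K : V -> V) (al be ga : V -> V -> F).
Hypothesis q : quaternion_triple I J K.
Hypothesis s : sp1_part I J K al be ga.
Hypothesis d : dual_to_line xi X0 I J K.

Let q2 := quaternion_cycle q.
Let q3 := quaternion_cycle q2.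
Let d2 := dual_cycle d.
Let d3 := dual_cycle d2.
Let s2 := sp1_cycle s.
Let s3 := sp1_cycle s2.

(** Since al, be, ga vanish on I xi, the endomorphism R_(I xi, J X0) commutes with
    I, J, K; but that endomorphism is ga itself. *)
Lemma ga_invariant x y :
  [/\ ga (I x) y = - ga x (I y), ga (J x) y = - ga x (J y)
    & ga (K x) y = - ga x (K y)].
Proof.
have [t22 t32 t12] := line_forms_on_frame q2 d2.
have [gI _ _] := ga_line_zero q s d (J X0).
have [_ _ aI] := ga_line_zero q2 s2 d2 (J X0).
have [_ bI _] := ga_line_zero q3 s3 d3 (J X0).
have [] := s (I xi) (J X0) x y.
rewrite gI bI aI !(curvature_along_Ixi s) t22 t32; split; lra.
Qed.

(** The three wedge relations leave on such z one number c_1 = al z (I X0),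
    c_2 = be z (J X0), c_3 = ga z (K X0) per form, with c_3 = - c_2, c_1 = - c_3
    and c_2 = - c_1: a cycle of three sign changes, so they are zero. *)
Lemma ga_horizontal_zero z y : ip (I xi) z = 0 -> ip (J xi) z = 0 -> ip (K xi) z = 0 ->
  ga z y = 0.
Proof.
move=> z1 z2 z3.
have [t11 t21 t31] := line_forms_on_frame q d.
have [t22 t32 t12] := line_forms_on_frame q2 d2.
have [t33 t13 t23] := line_forms_on_frame q3 d3.
have W x w := wedge_relation s x w z.
have W2 x w := wedge_relation s2 x w z.
have W3 x w := wedge_relation s3 x w z.
have e1 : ga z (K X0) = - be z (J X0).
  have := W (J X0) (K X0); rewrite z2 z3 t22 t32 t23 t33; lra.
have e2 : al z (I X0) = - ga z (K X0).
  have := W2 (K X0) (I X0); rewrite z1 z3 t11 t31 t13 t33; lra.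
have e3 : be z (J X0) = - al z (I X0).
  have := W3 (I X0) (J X0); rewrite z1 z2 t11 t21 t12 t22; lra.
have g2 : ga z (J X0) = 0.
  have := W2 (I X0) (J X0); rewrite z1 z3 t11 t31 t12 t32; lra.
have := W (J X0) y; rewrite z2 z3 t22 t32 g2.
have -> : be z (J X0) = 0 by lra.
lra.
Qed.

(** X0 is horizontal in the sense of the preceding lemma, and the invariance of
    ga carries the vanishing from X0 to I X0, J X0, K X0, which together with the
    horizontal vectors span everything. *)
Lemma ga_zero x y : ga x y = 0.
Proof.
have [e0 e1 e2 e3] := d.
have [t11 t21 t31] := line_forms_on_frame q d.
have [t22 t32 t12] := line_forms_on_frame q2 d2.
have [t33 t13 t23] := line_forms_on_frame q3 d3.
have g0 w : ga X0 w = 0 by apply: ga_horizontal_zero.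
have gX w : [/\ ga (I X0) w = 0, ga (J X0) w = 0 & ga (K X0) w = 0].
  by have [-> -> ->] := ga_invariant X0 w; rewrite !g0 oppr0.
have [gI gJ gK] := gX y.
pose c1 := ip (I xi) x; pose c2 := ip (J xi) x; pose c3 := ip (K xi) x.
pose z := - c1 *: I X0 + (- c2 *: J X0 + (- c3 *: K X0 + x)).
have : ga z y = 0.
  by apply: ga_horizontal_zero; rewrite /z !ipDr !ipZr
    ?(t11, t12, t13, t21, t22, t23, t31, t32, t33) /c1 /c2 /c3; ring.
by rewrite /z !(ga_lin q s d) gI gJ gK => <-; ring.
Qed.
End Vanishing.

Section Flat.
Variables (I J K : V -> V) (al be ga : V -> V -> F).
Hypothesis q : quaternion_triple I J K.
Hypothesis s : sp1_part I J K al be ga.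
Hypothesis d : dual_to_line xi X0 I J K.

Lemma curvature_invariant a b c e :
  [/\ k a b (I c) e = - k a b c (I e), k a b (J c) e = - k a b c (J e)
    & k a b (K c) e = - k a b c (K e)].
Proof.
have q2 := quaternion_cycle q; have s2 := sp1_cycle s; have d2 := dual_cycle d.
have q3 := quaternion_cycle q2; have s3 := sp1_cycle s2; have d3 := dual_cycle d2.
have [] := s a b c e.
rewrite !(ga_zero q s d) !(ga_zero q2 s2 d2) !(ga_zero q3 s3 d3).
by split; lra.
Qed.

Let curvature_invariant12 a b c e :
  [/\ k (I a) b c e = - k a (I b) c e, k (J a) b c e = - k a (J b) c e
    & k (K a) b c e = - k a (K b) c e].
Proof.
rewrite !(pair_symmetry _ b) !(pair_symmetry a).
by have [] := curvature_invariant c e a b.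
Qed.

Let curvature_on_line a b e : [/\ k a b (I xi) e = 0, k a b (J xi) e = 0 & k a b (K xi) e = 0].
Proof. by have [-> -> ->] := curvature_invariant a b xi e; rewrite !k_xi oppr0. Qed.

(** The value S_u v of a structure of linear type with all zeta^a = 0. *)
Definition linear_type (u v : V) : V :=
  ip u v *: xi - ip v xi *: u
  + ((ip (I v) xi *: I u - ip u (I v) *: I xi)
     + (ip (J v) xi *: J u - ip u (J v) *: J xi)
     + (ip (K v) xi *: K u - ip u (K v) *: K xi)).

(* The terms of S_u v along the line of xi are invisible to the curvature. *)
Let curvature_linear_type a b u v e : k a b (linear_type u v) e =
  - ip v xi * k a b u e + ip (I v) xi * k a b (I u) e
  + ip (J v) xi * k a b (J u) e + ip (K v) xi * k a b (K u) e.
Proof.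
have kD c c' : k a b (c + c') e = k a b c e + k a b c' e.
  by rewrite -[c in LHS]scale1r k_lin3 mul1r.
have k0 : k a b 0 e = 0 by have := kD 0 0; rewrite addr0; lra.
have kZ t c : k a b (t *: c) e = t * k a b c e.
  by rewrite -[_ *: _ in LHS]addr0 k_lin3 k0 addr0.
have kN c : k a b (- c) e = - k a b c e by rewrite -scaleN1r kZ mulN1r.
have [zI zJ zK] := curvature_on_line a b e.
by rewrite /linear_type !(kD, kN, kZ) k_xi zI zJ zK; ring.
Qed.

(* The second Bianchi identity, once nabla_u R has been replaced by the derivation
   action of S_u on R.  D is minus that action, paired with c and e; the signs come
   from S_u being skew. *)
Hypothesis second_bianchi :
  let D u v w c e :=
    k v w c (linear_type u e) + k v w (linear_type u c) e
    + k (linear_type u v) w c e + k v (linear_type u w) c e in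
  forall u v w c e, D u v w c e + D v w u c e + D w u v c e = 0.

(** In the cyclic sum the terms that carry a component of c or e cancel by the
    first Bianchi identity, and those that carry th_a(u), th_a(v), th_a(w) because
    R_(J_a v, w) = - R_(v, J_a w).  Each of the remaining three terms occurs
    twice. *)
Lemma theta_wedge_curvature u v w c e :
  ip xi u * k v w c e + ip xi v * k w u c e + ip xi w * k u v c e = 0.
Proof.
have := second_bianchi u v w c e => /=.
have k4 a b x y z : k a b x (linear_type y z) = - k a b (linear_type y z) x.
  exact: k_anti34.
have k1 a b x y z : k (linear_type y z) a b x = k b x (linear_type y z) a.
  exact: pair_symmetry.
have k2 a b x y z : k a (linear_type y z) b x = - k b x (linear_type y z) a.
  by rewrite k_anti12 k1.
have sym A (invA : forall x y, k c e (A x) y = - k c e x (A y)) x y :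
    k c e (A x) y = k c e (A y) x by rewrite invA k_anti34 opprK.
have sI := sym I (fun x y => let: And3 h _ _ := curvature_invariant c e x y in h).
have sJ := sym J (fun x y => let: And3 _ h _ := curvature_invariant c e x y in h).
have sK := sym K (fun x y => let: And3 _ _ h := curvature_invariant c e x y in h).
have iI a b x y := let: And3 h _ _ := curvature_invariant a b x y in h.
have iJ a b x y := let: And3 _ h _ := curvature_invariant a b x y in h.
have iK a b x y := let: And3 _ _ h := curvature_invariant a b x y in h.
have b1 y : k u v w y = - k v w u y - k w u v y.
  by have := k_bianchi u v w y; lra.
rewrite !k4 !k1 !k2 !curvature_linear_type !(ipC _ xi).
rewrite !(pair_symmetry _ _ c e) (sI v u) (sI w v) (sI w u).
rewrite (sJ v u) (sJ w v) (sJ w u) (sK v u) (sK w v) (sK w u).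
(* Twice: once for the terms ending in c and once for those ending in e. *)
do 2!rewrite (iI v w u) (iI w u v) (iI u v w) (iJ v w u) (iJ w u v) (iJ u v w)
  (iK v w u) (iK w u v) (iK u v w).
rewrite !b1 (k_anti34 c e v u) (k_anti34 c e w v) (k_anti34 c e u w).
move=> E.
apply: (@mulfI _ 2); first by rewrite pnatr_eq0.
rewrite mulr0 -[RHS]E; ring.
Qed.

(** With th(X0) = 1 and th_a(X0) = 0, the wedge identity says
    R_vw = th(v) R_(X0,w) - th(w) R_(X0,v), so all depends on R_(X0,z), which the
    invariance R_(I v, I w) = R_vw moves to arguments where th vanishes. *)
Lemma curvature_zero u v c e : k u v c e = 0.
Proof.
have [e0 e1 e2 e3] := d.
have T v' w := theta_wedge_curvature X0 v' w c e.
have xI w : ip xi (I w) = - ip (I xi) w by rewrite (qI_skew q) opprK.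
have xJ w : ip xi (J w) = - ip (J xi) w by rewrite (qJ_skew q) opprK.
have xK w : ip xi (K w) = - ip (K xi) w by rewrite (qK_skew q) opprK.
have h1 : k X0 (I X0) c e = 0.
  rewrite -(qJK q); have [_ + _] := curvature_invariant12 X0 (K X0) c e.
  have := T (J X0) (K X0); rewrite xJ xK e0 e2 e3; lra.
have h2 z : k X0 z c e = 0.
  have [+ _ _] := curvature_invariant12 X0 (I z) c e; rewrite (qII q).
  have kN : k X0 (- z) c e = - k X0 z c e.
    have k0 : k c e 0 X0 = 0 by have := k_lin3 1 c e 0 0 X0; rewrite scaler0 addr0; lra.
    have := k_lin3 (-1) c e z 0 X0; rewrite addr0 scaleN1r k0 => h.
    rewrite !(pair_symmetry _ _ c e) (k_anti34 c e X0 (- z)) h (k_anti34 c e X0 z); ring.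
  have := T (I X0) (I z); rewrite h1 e0 xI e1; lra.
have := T u v; rewrite e0 (k_anti12 v) !h2; lra.
Qed.
End Flat.
End QuaternionicCurvature.

(** * Functions of class C^k and symmetry of second derivatives *)

Section Calculus.
Variables (R : realType) (U : normedModType R).

Lemma differentiable_mx p q (A : U -> 'M[R]_(p, q)) x :
  (forall i j, differentiable (fun y => A y i j : R^o) x) -> differentiable A x.
Proof.
move=> dA.
have -> : A = \sum_(i < p) \sum_(j < q) (fun y => A y i j *: delta_mx i j).
  apply/funext => y; rewrite fct_sumE [LHS]matrix_sum_delta.
  by apply: eq_bigr => i _; rewrite fct_sumE.
apply: differentiable_sum => i; apply: differentiable_sum => j.
exact: (@differentiableZl _ _ _ (fun y => A y i j)).
Qed.

Lemma differentiable_entry p q (A : U -> 'M[R]_(p, q)) x i j :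
  differentiable A x -> differentiable (fun y => A y i j : R^o) x.
Proof.
move=> dA; apply: (@differentiable_comp _ _ _ _ A (fun N : 'M[R]_(p,q) => N i j : R^o)) => //.
exact: differentiable_coord.
Qed.

Lemma derivable_mulmx p q r (A : U -> 'M[R]_(p, q)) (B : U -> 'M[R]_(q, r)) x v :
  derivable A x v -> derivable B x v ->
  derivable (fun y => A y *m B y) x v.
Proof.
move=> /derivable_mxP dA /derivable_mxP dB; apply/derivable_mxP => i j.
have -> : (fun y => (A y *m B y) i j : R^o) =
   \sum_(k < q) ((fun y => A y i k) * (fun y => B y k j)).
  by apply/funext => y; rewrite fct_sumE mxE.
by apply: derivable_sum => k; apply: derivableM.
Qed.

Lemma derive_entry p q (A : U -> 'M[R]_(p, q)) x v i j :
  derivable A x v -> 'D_v (fun y => A y i j : R^o) x = ('D_v A x) i j.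
Proof. by move=> dA; rewrite derive_mx ?mxE. Qed.

Lemma derive_mulmx p q r (A : U -> 'M[R]_(p, q)) (B : U -> 'M[R]_(q, r)) x v :
  derivable A x v -> derivable B x v ->
  'D_v (fun y => A y *m B y) x = 'D_v A x *m B x + A x *m 'D_v B x.
Proof.
move=> dA dB; have dAB := derivable_mulmx dA dB.
apply/matrixP => i j; rewrite -derive_entry //.
have -> : (fun y => (A y *m B y) i j : R^o) =
   \sum_(k < q) ((fun y => A y i k) * (fun y => B y k j)).
  by apply/funext => y; rewrite fct_sumE mxE.
have eA k := (derivable_mxP _ _ _).1 dA i k.
have eB k := (derivable_mxP _ _ _).1 dB k j.
rewrite derive_sum; last by move=> k; apply: derivableM.
rewrite !mxE -big_split /=; apply: eq_bigr => k _.
rewrite deriveM // !derive_entry // addrC /GRing.scale /=.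
by rewrite [B x k j * _]mulrC.
Qed.

Lemma near_eq_differentiable (V : normedModType R) (f g : U -> V) x :
  {near x, f =1 g} -> differentiable f x -> differentiable g x.
Proof.
move=> fg df.
have -> : g = f + (g - f) by apply/funext => y; rewrite !fctE addrC subrK.
apply: differentiableD => //.
have gf0 : (g - f) \o shift x = cst ((g - f) x) + (0 : U -> V) +o_ 0 id.
  apply/eqaddoP => e e0; near=> y.
  rewrite !fctE /= (nbhs_singleton fg) subrr addr0 subr0.
  have -> : f (y + x) = g (y + x).
    near: y.
    by move: fg; rewrite nearE /= (near_shift 0 x) subr0; apply.
  by rewrite subrr normr0 mulr_ge0 // ltW.
apply/diff_locallyP.
have -> : 'd (g - f) x = (0 : U -> V) :> (U -> V).
  exact: (@diff_unique _ _ _ _ (\0 : {linear U -> V})%R _ (@cst_continuous _ _ _) gf0).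
by split; first exact: cst_continuous.
Unshelve. all: by end_near. Qed.

Lemma is_derive_line (V : normedModType R) (f : U -> V) (y u : U) (s : R) :
  derivable f (s *: u + y) u ->
  is_derive s 1 (fun s : R => f (s *: u + y)) ('D_u f (s *: u + y)).
Proof.
move=> df.
have e : (fun h : R => h^-1 *: (((fun s : R => f (s *: u + y)) \o shift s) (h *: 1) - f (s *: u + y)))
  = (fun h : R => h^-1 *: ((f \o shift (s *: u + y)) (h *: u) - f (s *: u + y))).
  apply/funext => h /=; congr (_ *: (f _ - _)).
  by rewrite [_ *: 1]mulr1 scalerDl addrA.
apply: DeriveDef; first by rewrite /derivable e.
by rewrite /derive e.
Qed.

(** The mean value theorem in the direction u writes the second difference as t
    times an increment of 'D_u f in the direction v; differentiability of 'D_u f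
    at x gives that increment up to o(t). *)
Lemma second_difference (f : U -> R^o) (x u v : U) :
  (\forall y \near x, differentiable f y) ->
  differentiable (fun y => 'D_u f y : R^o) x ->
  forall e, 0 < e -> \forall t \near (0 : R)^'+,
    `|f (t *: u + (t *: v + x)) - f (t *: u + x) - f (t *: v + x) + f x
      - t ^+ 2 * 'D_v (fun y => 'D_u f y : R^o) x| <= e * t ^+ 2.
Proof.
move=> df ddf e e0.
set fu := fun y => 'D_u f y.
pose c := `|u| + `|v|.
have c0 : 0 <= c by rewrite addr_ge0.
pose d := e / (2 * c + 1).
have d0 : 0 < d by rewrite divr_gt0 // ltr_pwDr // mulr_ge0.
have /diff_locally /eqaddoP /(_ _ d0) /= od := ddf.
rewrite (deriveE _ ddf); set L := 'd _ x in od *.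
have : \forall h \near (0 : U), differentiable f (h + x) /\
     `|fu (h + x) - (fu x + L h)| <= d * `|h|.
  near=> h; split; last by near: h; exact: od.
  near: h; move: df; rewrite nearE /= (near_shift 0 x) subr0; apply.
move=> /nbhs_ballP [r /= r0 hr].
have {}hr h : `|h| < r -> differentiable f (h + x) /\
     `|fu (h + x) - (fu x + L h)| <= d * `|h|.
  by move=> hh; apply: hr; rewrite -ball_normE /= sub0r normrN.
near=> t.
have t0 : 0 < t by near: t; exact: nbhs_right_gt.
have tr : t * (c + 1) < r.
  rewrite -ltr_pdivlMr ?ltr_wpDl //.
  by near: t; apply: nbhs_right_lt; rewrite divr_gt0 // ltr_wpDl.
have tcr s a : 0 <= s <= t -> a = 0 \/ a = t -> `|s *: u + a *: v| <= t * c.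
  move=> /andP[s0 st] at0; rewrite (le_trans (ler_normD _ _)) // !normrZ [leRHS]mulrDr.
  rewrite lerD // ler_wpM2r //; first by rewrite ger0_norm.
  by case: at0 => ->; rewrite ?normr0 ?ger0_norm // ltW.
have tcr' s a : 0 <= s <= t -> a = 0 \/ a = t -> `|s *: u + a *: v| < r.
  move=> h1 h2; apply: le_lt_trans (tcr _ _ h1 h2) _.
  by apply: lt_trans tr; rewrite ltr_pM2l // ltrDl.
pose phi (s : R) := f (s *: u + (t *: v + x)) - f (s *: u + x) : R^o.
have dphi (s : R) : 0 <= s <= t ->
   is_derive s 1 phi (fu (s *: u + (t *: v + x)) - fu (s *: u + x)).
  move=> st; apply: is_deriveB; apply: is_derive_line; apply: diff_derivable.
    by rewrite addrA; apply: (hr _ _).1; apply: tcr' => //; right.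
  by have := (hr _ (tcr' s 0 st (or_introl erefl))).1; rewrite scale0r addr0.
have [s st Es] : exists2 s, s \in `[0, t]%R & phi t - phi 0 =
   (fu (s *: u + (t *: v + x)) - fu (s *: u + x)) * (t - 0).
  apply: MVT_segment => [|y yt|]; first exact: ltW.
    by apply: dphi; rewrite in_itv /= in yt; case/andP: yt => a b; rewrite !ltW.
  apply: derivable_within_continuous => y; rewrite in_itv /= => yt.
  by have [] := dphi _ yt.
rewrite in_itv /= in st.
have -> : f (t *: u + (t *: v + x)) - f (t *: u + x) - f (t *: v + x) + f x
   = phi t - phi 0.
  by rewrite /phi !scale0r !add0r opprB -!addrA [- _ + f x]addrC.
have h1 := (hr _ (tcr' s t st (or_intror erefl))).2.
have h2 := (hr _ (tcr' s 0 st (or_introl erefl))).2.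
have b1 := tcr s t st (or_intror erefl).
have b2 := tcr s 0 st (or_introl erefl).
rewrite {}Es subr0.
have Lst a : L (s *: u + a *: v) = s *: L u + a *: L v.
  by rewrite linearD !linearZ.
rewrite !Lst -addrA in h1 h2.
rewrite !scale0r !addr0 in h2 b2.
have -> : (fu (s *: u + (t *: v + x)) - fu (s *: u + x)) * t - t ^+ 2 * L v
  = t * ((fu (s *: u + (t *: v + x)) - (fu x + (s *: L u + t *: L v)))
         - (fu (s *: u + x) - (fu x + s *: L u))).
  by rewrite /GRing.scale /=; ring.
rewrite normrM gtr0_norm // expr2 mulrA [e * t]mulrC -[t * e * t]mulrA.
rewrite ler_pM2l // (le_trans (ler_normB _ _)) //.
apply: (@le_trans _ _ (d * (t * c) + d * (t * c))).
  by apply: lerD; [apply: le_trans h1 _|apply: le_trans h2 _]; rewrite ler_wpM2l // ltW.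
have -> : e = d * (2 * c + 1) by rewrite divfK // gt_eqF // ltr_pwDr // mulr_ge0.
have : 0 <= d * t by rewrite mulr_ge0 // ltW.
nra.
Unshelve. all: by end_near. Qed.
(** The second difference is symmetric in u and v, hence so is its leading
    coefficient. *)
Lemma schwarz_scalar (f : U -> R^o) (x u v : U) :
  (\forall y \near x, differentiable f y) ->
  differentiable (fun y => 'D_u f y : R^o) x ->
  differentiable (fun y => 'D_v f y : R^o) x ->
  'D_u (fun y => 'D_v f y : R^o) x = 'D_v (fun y => 'D_u f y : R^o) x.
Proof.
move=> df du dv; apply/eqP; rewrite -subr_eq0 -normr_le0.
apply/ler_addgt0Pl => e e0; rewrite addr0.
have e2 : 0 < e / 2 by rewrite divr_gt0.
have h1 := @second_difference f x u v df du _ e2.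
have h2 := @second_difference f x v u df dv _ e2.
have h0 : \forall t \near (0 : R)^'+, 0 < t by exact: nbhs_right_gt.
have [t [[t0 ht1] ht2]] := filter_ex (filterI (filterI h0 h1) h2).
have t20 : 0 < t ^+ 2 by rewrite exprn_gt0.
move: ht1 ht2; rewrite !addrA [t *: v + t *: u]addrC.
move: ('D_u (fun y => 'D_v f y : R^o) x) ('D_v (fun y => 'D_u f y : R^o) x) => p q.
move: (f (t *: u + t *: v + x)) (f (t *: u + x)) (f (t *: v + x)) (f x) => a b c d ht1 ht2.
rewrite -(ler_pM2l t20) -{1}(gtr0_norm t20) -normrM [t ^+ 2 * e]mulrC.
have -> : t ^+ 2 * (p - q) = (a - b - c + d - t ^+ 2 * q) - (a - c - b + d - t ^+ 2 * p).
  by ring.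
rewrite (le_trans (ler_normB _ _)) // (le_trans (lerD ht1 ht2)) //.
by rewrite -mulrDl -splitr.
Qed.

Variable O : set U.
Hypothesis openO : open O.

Lemma near_open x : O x -> \forall y \near x, O y.
Proof. by move=> Ox; apply: open_nbhs_nbhs. Qed.

Lemma near_on (T : Type) (f g : U -> T) x :
  O x -> (forall y, O y -> f y = g y) -> {near x, f =1 g}.
Proof. by move=> Ox fg; apply: filterS (near_open Ox) => y /fg. Qed.

Lemma derive_on (V : normedModType R) (f g : U -> V) x v :
  O x -> (forall y, O y -> f y = g y) -> 'D_v f x = 'D_v g x.
Proof. by move=> Ox fg; apply: near_eq_derive; apply: near_on. Qed.

(** Derivatives see a whole neighbourhood, so replacing f by g needs O open. *)
Lemma Ck_ext (V : normedModType R) k (f g : U -> V) :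
  (forall y, O y -> f y = g y) -> Ck_on k O f -> Ck_on k O g.
Proof.
elim: k f g => [|k IH] f g fg /=.
  move=> cf x Ox; rewrite /prop_for /continuous_at -fg //.
  apply: cvg_trans (cf x Ox); apply: near_eq_cvg.
  exact: near_on.
move=> [df cdf]; split=> [x Ox|v].
  by apply: near_eq_differentiable (df x Ox); apply: near_on.
by apply: IH (cdf v) => y Oy; apply: derive_on.
Qed.

Lemma Ck_prev (V : normedModType R) k (f : U -> V) :
  Ck_on k.+1 O f -> Ck_on k O f.
Proof.
elim: k f => [|k IH] f /= [df cdf].
  by move=> x Ox; apply: differentiable_continuous; apply: df.
by split=> // v; apply: IH.
Qed.

Lemma Ck_cst (V : normedModType R) k (a : V) : Ck_on k O (fun=> a).
Proof.
elim: k a => [|k IH] a /=; first by move=> x _; apply: cst_continuous.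
split=> [x _|v]; first exact: differentiable_cst.
by apply: Ck_ext (IH 0) => y _; rewrite derive_cst.
Qed.

Lemma CkD (V : normedModType R) k (f g : U -> V) :
  Ck_on k O f -> Ck_on k O g -> Ck_on k O (fun y => f y + g y).
Proof.
elim: k f g => [|k IH] f g /=.
  by move=> cf cg x Ox; apply: continuousD; [apply: cf|apply: cg].
move=> [df cf] [dg cg]; split=> [x Ox|v].
  by apply: differentiableD; [apply: df|apply: dg].
apply: Ck_ext (IH _ _ (cf v) (cg v)) => y Oy.
by rewrite deriveD //; apply: diff_derivable; [apply: df|apply: dg].
Qed.

Lemma CkN (V : normedModType R) k (f : U -> V) :
  Ck_on k O f -> Ck_on k O (fun y => - f y).
Proof.
elim: k f => [|k IH] f /=.
  by move=> cf x Ox; apply: continuousN; apply: cf.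
move=> [df cf]; split=> [x Ox|v].
  by apply: differentiableN; apply: df.
apply: Ck_ext (IH _ (cf v)) => y Oy.
by rewrite deriveN //; apply: diff_derivable; apply: df.
Qed.

Lemma CkM k (f g : U -> R^o) :
  Ck_on k O f -> Ck_on k O g -> Ck_on k O (fun y => f y * g y : R^o).
Proof.
elim: k f g => [|k IH] f g.
  by move=> cf cg x Ox; apply: continuousM; [apply: cf|apply: cg].
move=> cf cg; have [df cdf] := cf; have [dg cdg] := cg; split=> [x Ox|v].
  by apply: differentiableM; [apply: df|apply: dg].
apply: Ck_ext (CkD (IH _ _ (Ck_prev cf) (cdg v)) (IH _ _ (Ck_prev cg) (cdf v))).
move=> y Oy.
by rewrite deriveM //; apply: diff_derivable; [apply: df|apply: dg].
Qed.

Lemma Ck_sum (V : normedModType R) k (T : Type) (r : seq T) (P : pred T)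
    (f : T -> U -> V) :
  (forall i, P i -> Ck_on k O (f i)) -> Ck_on k O (fun y => \sum_(i <- r | P i) f i y).
Proof.
move=> cf; elim: r => [|i r IH].
  by apply: Ck_ext (Ck_cst k 0) => y _; rewrite big_nil.
case Pi : (P i); last by apply: Ck_ext IH => y _; rewrite big_cons Pi.
by apply: Ck_ext (CkD (cf i Pi) IH) => y _; rewrite big_cons Pi.
Qed.

Lemma Ck_prod k (T : Type) (r : seq T) (f : T -> U -> R^o) :
  (forall i, Ck_on k O (f i)) -> Ck_on k O (fun y => \prod_(i <- r) f i y : R^o).
Proof.
move=> cf; elim: r => [|i r IH].
  by apply: Ck_ext (Ck_cst k (1 : R^o)) => y _; rewrite big_nil.
by apply: Ck_ext (CkM (cf i) IH) => y _; rewrite big_cons.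
Qed.

Lemma CkV k (f : U -> R^o) :
  (forall y, O y -> f y != 0) -> Ck_on k O f -> Ck_on k O (fun y => (f y)^-1 : R^o).
Proof.
move=> f0; elim: k => [|k IH].
  by move=> cf x Ox; apply: continuousV; [apply: f0|apply: cf].
move=> cf; have [df cdf] := cf; split=> [x Ox|v].
  by apply: differentiableV; [apply: df|apply: f0].
have cV := IH (Ck_prev cf).
apply: Ck_ext (CkN (CkM (CkM cV cV) (cdf v))) => y Oy.
rewrite deriveV; [|exact: f0|by apply: diff_derivable; apply: df].
by rewrite expr2 invfM [RHS]scaleNr.
Qed.

Lemma Ck_entry p q k (A : U -> 'M[R]_(p, q)) i j :
  Ck_on k O A -> Ck_on k O (fun y => A y i j : R^o).
Proof.
elim: k A => [|k IH] A /=.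
  move=> cA x Ox; apply: (@continuous_comp _ _ _ A (fun N : 'M[R]_(p, q) => N i j : R^o)).
    exact: cA.
  exact: coord_continuous.
move=> [dA cA]; split=> [x Ox|v].
  by apply: differentiable_entry; apply: dA.
apply: Ck_ext (IH _ (cA v)) => y Oy.
by rewrite derive_entry //; apply: diff_derivable; apply: dA.
Qed.

Lemma Ck_mx p q k (A : U -> 'M[R]_(p, q)) :
  (forall i j, Ck_on k O (fun y => A y i j : R^o)) -> Ck_on k O A.
Proof.
elim: k A => [|k IH] A /=.
  move=> cA x Ox.
  apply/cvgrPdist_le => /= e e0; near=> y.
  rewrite /Num.Def.normr/= mx_normrE (bigmax_le _ (ltW e0))//= => i _.
  rewrite !mxE; move: i; near: y; apply: filter_forall => /= i.
  exact: ((cvgrPdist_le _ _).1 (cA i.1 i.2 x Ox)).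
move=> cA; have dA x : O x -> differentiable A x.
  by move=> Ox; apply: differentiable_mx => i j; apply: (cA i j).1.
split=> [//|v]; apply: IH => i j.
apply: Ck_ext ((cA i j).2 v) => y Oy.
by rewrite derive_entry //; apply: diff_derivable; apply: dA.
Unshelve. all: by end_near. Qed.

Lemma Ck_mulmx p q r k (A : U -> 'M[R]_(p, q)) (B : U -> 'M[R]_(q, r)) :
  Ck_on k O A -> Ck_on k O B -> Ck_on k O (fun y => A y *m B y).
Proof.
move=> cA cB; apply: Ck_mx => i j.
have c := @Ck_sum R^o k _ (index_enum 'I_q) xpredT _
   (fun l _ => CkM (Ck_entry i l cA) (Ck_entry l j cB)).
by apply: Ck_ext c => y _; rewrite mxE.
Qed.

Lemma Ck_det p k (A : U -> 'M[R]_p) :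
  Ck_on k O A -> Ck_on k O (fun y => \det (A y) : R^o).
Proof.
move=> cA; apply: (@Ck_sum R^o) => s _; apply: CkM; first exact: Ck_cst.
by apply: Ck_prod => i; apply: Ck_entry.
Qed.

(** By the cofactor formula. *)
Lemma Ck_invmx p k (A : U -> 'M[R]_p) :
  (forall y, O y -> A y \in unitmx) -> Ck_on k O A -> Ck_on k O (fun y => invmx (A y)).
Proof.
move=> uA cA; apply: Ck_mx => i j.
have cC : Ck_on k O (fun y => cofactor (A y) j i : R^o).
  apply: CkM; first exact: Ck_cst.
  apply: Ck_det; apply: Ck_mx => a b.
  by apply: Ck_ext (Ck_entry (lift j a) (lift i b) cA) => y _; rewrite !mxE.
have dn0 y : O y -> \det (A y) != 0 by move/uA; rewrite unitmxE unitfE.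
apply: Ck_ext (CkM (CkV dn0 (Ck_det cA)) cC) => y Oy.
by rewrite /invmx uA // !mxE.
Qed.

Lemma smooth_derive (V : normedModType R) (f : U -> V) v :
  smooth_on O f -> smooth_on O (fun y => 'D_v f y).
Proof. by move=> sf k; apply: (sf k.+1).2. Qed.

Lemma smooth_differentiable (V : normedModType R) (f : U -> V) x :
  smooth_on O f -> O x -> differentiable f x.
Proof. by move=> sf; apply: (sf 1%N).1. Qed.

Lemma smooth_derivable (V : normedModType R) (f : U -> V) x v :
  smooth_on O f -> O x -> derivable f x v.
Proof. by move=> sf Ox; apply: diff_derivable; apply: smooth_differentiable. Qed.

Lemma schwarz p q (f : U -> 'M[R]_(p, q)) (x u v : U) :
  smooth_on O f -> O x ->
  'D_u (fun y => 'D_v f y) x = 'D_v (fun y => 'D_u f y) x.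
Proof.
move=> sf Ox; apply/matrixP => i j.
have dd w z a : O z -> derivable (fun y => 'D_w f y) z a.
  by move=> Oz; apply: smooth_derivable => //; apply: smooth_derive.
etransitivity; first exact: esym (derive_entry i j (dd v x u Ox)).
etransitivity; last exact: (derive_entry i j (dd u x v Ox)).
have sij : smooth_on O (fun y => f y i j : R^o) by move=> k; apply: Ck_entry.
have e w y : O y -> 'D_w f y i j = 'D_w (fun y => f y i j : R^o) y.
  by move=> Oy; rewrite derive_entry //; apply: smooth_derivable.
etransitivity; first exact: (derive_on _ Ox (e v)).
etransitivity; last exact: esym (derive_on _ Ox (e u)).
apply: schwarz_scalar.
- by apply: filterS (near_open Ox) => y Oy; apply: smooth_differentiable.
- by apply: smooth_differentiable => //; apply: smooth_derive.
- by apply: smooth_differentiable => //; apply: smooth_derive.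
Qed.

End Calculus.


(** * Matrix identities *)

(* Directional derivatives are atoms from here on: unfolding them into limits makes
   conversion tests on long expressions intractable. *)
#[local] Opaque derive.

Section MatrixEntries.
Variables (R : realType) (p q : nat).
Implicit Types (A B : 'M[R]_(p, q)).
Lemma add_mxE A B i j : (A + B) i j = A i j + B i j. Proof. by rewrite mxE. Qed.
Lemma opp_mxE A i j : (- A) i j = - A i j. Proof. by rewrite mxE. Qed.
Lemma scale_mxE (a : R) A i j : (a *: A) i j = a * A i j. Proof. by rewrite mxE. Qed.
Lemma zero_mxE i j : (0 : 'M[R]_(p, q)) i j = 0. Proof. by rewrite mxE. Qed.
Definition mx_linE := (add_mxE, opp_mxE, scale_mxE, zero_mxE).
End MatrixEntries.

(* Restated for a real field so that rewriting always produces one and the same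
   elaboration of matrix operations. *)
Section MatrixProducts.
Variables (R : realType) (p q r t : nat).
Implicit Types (A : 'M[R]_(p, q)) (B : 'M[R]_(q, r)).
Lemma mxDl A A' B : (A + A') *m B = A *m B + A' *m B. Proof. exact: mulmxDl. Qed.
Lemma mxDr A B B' : A *m (B + B') = A *m B + A *m B'. Proof. exact: mulmxDr. Qed.
Lemma mxNl A B : (- A) *m B = - (A *m B). Proof. exact: mulNmx. Qed.
Lemma mxNr A B : A *m (- B) = - (A *m B). Proof. exact: mulmxN. Qed.
Lemma mxZl a A B : (a *: A) *m B = a *: (A *m B). Proof. by rewrite scalemxAl. Qed.
Lemma mxZr a A B : A *m (a *: B) = a *: (A *m B). Proof. by rewrite scalemxAr. Qed.
Lemma mxA A B (D : 'M[R]_(r, t)) : (A *m B) *m D = A *m (B *m D).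
Proof. by rewrite mulmxA. Qed.
Definition mx_expand := (mxDl, mxDr, mxNl, mxNr, mxZl, mxZr, mxA).
End MatrixProducts.

(** Noncommutative ring identities between matrices: expand, make each product an
    atom, and compare entries.  Equal products may be elaborated along different
    paths of the algebraic hierarchy, whence the search up to unification. *)
Ltac mx_ring :=
  try (rewrite !mx_expand);
  repeat match goal with |- context [@mulmx ?R ?m ?n ?p ?A ?B] =>
    lazymatch A with context [@mulmx] => fail | _ =>
    lazymatch B with context [@mulmx] => fail | _ =>
    let z := fresh "z" in pose z := @mulmx R m n p A B;
    repeat match goal with |- context [@mulmx ?S m n p ?A' ?B'] =>
      unify A A'; unify B B'; change (@mulmx S m n p A' B') with z end;
    clearbody z end end end;
  let i := fresh "i" in let j := fresh "j" in
  (apply/matrixP => i j; rewrite !mx_linE; ring).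

(** * Smooth fields and their derivatives *)

Section SmoothClosure.
Variables (R : realType) (U : normedModType R) (O : set U).
Hypothesis openO : open O.

Lemma smooth_cst (V : normedModType R) (a : V) : smooth_on O (fun=> a).
Proof. by move=> k; apply: Ck_cst. Qed.
Lemma smoothD (V : normedModType R) (f g : U -> V) :
  smooth_on O f -> smooth_on O g -> smooth_on O (fun y => f y + g y).
Proof. by move=> sf sg k; apply: CkD. Qed.
Lemma smoothN (V : normedModType R) (f : U -> V) :
  smooth_on O f -> smooth_on O (fun y => - f y).
Proof. by move=> sf k; apply: CkN. Qed.
Lemma smooth_mulmx p q r (A : U -> 'M[R]_(p, q)) (B : U -> 'M[R]_(q, r)) :
  smooth_on O A -> smooth_on O B -> smooth_on O (fun y => A y *m B y).
Proof. by move=> sA sB k; apply: Ck_mulmx. Qed.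
Lemma Ck_subset (V : normedModType R) (O' : set U) k (f : U -> V) :
  O' `<=` O -> Ck_on k O f -> Ck_on k O' f.
Proof.
move=> sub; elim: k f => [|k IH] f /=; first by move=> cf x /sub; apply: cf.
by move=> [df cf]; split=> [x /sub|v]; [apply: df|apply: IH].
Qed.

Lemma derive_add (V : normedModType R) (f g : U -> V) x v :
  derivable f x v -> derivable g x v ->
  'D_v (fun y => f y + g y) x = 'D_v f x + 'D_v g x.
Proof. exact: deriveD. Qed.
Lemma derive_sub (V : normedModType R) (f g : U -> V) x v :
  derivable f x v -> derivable g x v ->
  'D_v (fun y => f y - g y) x = 'D_v f x - 'D_v g x.
Proof. exact: deriveB. Qed.

Lemma derive_dirZD (V : normedModType R) (f : U -> V) x (a : R) u v :
  differentiable f x -> 'D_(a *: u + v) f x = a *: 'D_u f x + 'D_v f x.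
Proof. by move=> df; rewrite !deriveE // linearP. Qed.

Lemma derive_mulmx_cst p q r (A : U -> 'M[R]_(p, q)) (B : 'M[R]_(q, r)) x v :
  derivable A x v -> 'D_v (fun y => A y *m B) x = 'D_v A x *m B.
Proof.
move=> dA; rewrite (derive_mulmx dA (derivable_cst B x v)).
by rewrite derive_cst mulmx0 addr0.
Qed.

Lemma derive_cst_mulmx p q r (A : 'M[R]_(p, q)) (B : U -> 'M[R]_(q, r)) x v :
  derivable B x v -> 'D_v (fun y => A *m B y) x = A *m 'D_v B x.
Proof.
move=> dB; rewrite (derive_mulmx (derivable_cst A x v) dB).
by rewrite derive_cst mul0mx add0r.
Qed.

Lemma derivable_trmx p q (A : U -> 'M[R]_(p, q)) x v :
  derivable A x v -> derivable (fun y => (A y)^T) x v.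
Proof.
move=> /derivable_mxP dA; apply/derivable_mxP => i j.
have -> : (fun y => (A y)^T i j) = (fun y => A y j i) by apply/funext => y; rewrite mxE.
exact: dA.
Qed.

Lemma derive_trmx p q (A : U -> 'M[R]_(p, q)) x v :
  derivable A x v -> 'D_v (fun y => (A y)^T) x = ('D_v A x)^T.
Proof.
move=> dA; apply/matrixP => i j; rewrite [RHS]mxE.
rewrite -(derive_entry j i dA) -(derive_entry i j (derivable_trmx dA)).
by congr ('D_v _ x); apply/funext => y; rewrite mxE.
Qed.

End SmoothClosure.

(** * The Levi-Civita connection form *)

Section LeviCivita.
Variables (R : realType) (m : nat) (O : set 'cV[R]_m) (G : 'cV[R]_m -> 'M[R]_m).
Hypotheses (openO : open O) (smoothG : smooth_on O G).
Hypothesis symG : forall x, O x -> (G x)^T = G x.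
Hypothesis unitG : forall x, O x -> G x \in unitmx.
Local Notation C := (levi_civita G).

Let derivable_G x (u : 'cV[R]_m) : O x -> derivable G x u.
Proof. by move=> Ox; apply: (smooth_derivable smoothG Ox). Qed.

Lemma derive_metric_sym x (u : 'cV[R]_m) : O x -> ('D_u G x)^T = 'D_u G x.
Proof.
move=> Ox; rewrite -(derive_trmx (@derivable_G x u Ox)).
exact: (derive_on openO _ Ox symG).
Qed.

Lemma derive_metric_dir x (v : 'cV[R]_m) : O x -> 'D_v G x = \sum_j v j 0 *: 'D_(delta_mx j 0) G x.
Proof.
move=> Ox; have df : differentiable G x by apply: (smooth_differentiable smoothG Ox).
rewrite (deriveE _ df) [v in LHS]matrix_sum_delta linear_sum.
apply: eq_bigr => j _; rewrite big_ord1 linearZ /=.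
by rewrite (deriveE _ df).
Qed.

Lemma lower_connection x (u : 'cV[R]_m) l j : O x ->
  (G x *m C x u) l j = 2^-1 * (('D_u G x) l j + ('D_(delta_mx j 0) G x *m u) l 0
                    - ('D_(delta_mx l 0) G x *m u) j 0).
Proof.
by move=> Ox; rewrite /levi_civita -scalemxAr (mulKVmx (unitG Ox)) scale_mxE [X in _ * X]mxE.
Qed.

(** In G C_u, the first term of the Koszul formula is symmetric and the other two
    are exchanged, up to sign, by transposition. *)
Lemma connection_metric x (u : 'cV[R]_m) : O x -> 'D_u G x = (C x u)^T *m G x + G x *m C x u.
Proof.
move=> Ox; apply/matrixP => i j.
have -> : (C x u)^T *m G x = (G x *m C x u)^T by rewrite trmx_mul symG.
rewrite add_mxE [(trmx _) _ _]mxE (lower_connection u i j Ox) (lower_connection u j i Ox).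
have := congr1 (fun M : 'M[R]_m => M i j) (derive_metric_sym u Ox); rewrite mxE.
lra.
Qed.

(** Lowered by G, the vector C_u v is half of ('D_u G) v + ('D_v G) u minus the
    gradient term, which is symmetric in u and v because G is. *)
Lemma connection_torsionfree x (u v : 'cV[R]_m) : O x -> C x u *m v = C x v *m u.
Proof.
move=> Ox.
suff E : G x *m (C x u *m v) = G x *m (C x v *m u).
  by rewrite -[LHS](mulKmx (unitG Ox)) E mulKmx // unitG.
apply/matrixP => l j; rewrite ord1.
have F (a b : 'cV[R]_m) : (G x *m (C x a *m b)) l 0 =
   2^-1 * (('D_a G x *m b) l 0 + ('D_b G x *m a) l 0 - (b^T *m 'D_(delta_mx l 0) G x *m a) 0 0).
  rewrite mulmxA mxE.
  under eq_bigr => j0 _ do rewrite lower_connection //.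
  rewrite [in X in _ = _ * (_ + X - _)](derive_metric_dir b Ox) mulmx_suml summxE.
  rewrite -mulmxA [in X in _ - X]mxE [('D_a G x *m b) l 0]mxE -big_split -sumrB mulr_sumr.
  apply: eq_bigr => k _ /=.
  rewrite -scalemxAl scale_mxE [(trmx b) _ _]mxE; ring.
rewrite !F.
have -> : (v^T *m 'D_(delta_mx l 0) G x *m u) 0 0 = (u^T *m 'D_(delta_mx l 0) G x *m v) 0 0.
  have -> : v^T *m 'D_(delta_mx l 0) G x *m u = (u^T *m 'D_(delta_mx l 0) G x *m v)^T.
    by rewrite !trmx_mul trmxK derive_metric_sym // mulmxA.
  by rewrite mxE.
ring.
Qed.

Lemma connection_smooth (u : 'cV[R]_m) : smooth_on O (fun x => C x u).
Proof.
have sD w : smooth_on O (fun x => 'D_w G x) by apply: smooth_derive.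
have sDu w : smooth_on O (fun x => 'D_w G x *m u).
  by apply: smooth_mulmx => //; apply: smooth_cst.
move=> k; apply: (Ck_mx openO) => l j.
have cB : Ck_on k O (fun x => \matrix_(l, j) (('D_u G x) l j
             + ('D_(delta_mx j 0) G x *m u) l 0 - ('D_(delta_mx l 0) G x *m u) j 0)).
  apply: (Ck_mx openO) => a b.
  have c := CkD openO (CkD openO (Ck_entry openO a b (sD u k)) (Ck_entry openO a 0 (sDu (delta_mx b 0) k)))
     (CkN openO (Ck_entry openO b 0 (sDu (delta_mx a 0) k))).
  by apply: (Ck_ext openO _ c) => y _; rewrite [RHS]mxE.
have c := CkM openO (Ck_cst openO k (2^-1 : R^o))
   (Ck_entry openO l j (Ck_mulmx openO (Ck_invmx openO unitG (smoothG k)) cB)).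
by apply: (Ck_ext openO _ c) => y _; rewrite /levi_civita [RHS]scale_mxE.
Qed.

Lemma connection_sub x (u v : 'cV[R]_m) : O x -> C x (u - v) = C x u - C x v.
Proof.
move=> Ox; apply/matrixP => i j.
have e w : C x w i j = (C x w *m (delta_mx j 0 : 'cV[R]_m)) i 0.
  by rewrite -(colE j (C x w)) [RHS]mxE.
have tf w : C x w *m delta_mx j 0 = C x (delta_mx j 0) *m w.
  exact: connection_torsionfree.
by rewrite add_mxE opp_mxE !e !tf mulmxBr add_mxE opp_mxE.
Qed.
End LeviCivita.

(** * Bianchi identities *)

Section Curvature.
Variables (R : realType) (m : nat) (O : set 'cV[R]_m).
Variable C : 'cV[R]_m -> 'cV[R]_m -> 'M[R]_m.
Hypotheses (openO : open O).
Hypothesis smoothC : forall u, smooth_on O (fun x => C x u).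
Hypothesis torsionfree : forall x u v, O x -> C x u *m v = C x v *m u.
Local Notation K := (curvature C).
Implicit Types (u v w : 'cV[R]_m).

Let derivable_C x u v : O x -> derivable (fun y => C y u) x v.
Proof. by move=> Ox; apply: (smooth_derivable (smoothC u) Ox). Qed.

Lemma curvature_anti x u v : K x u v = - K x v u.
Proof. by apply/matrixP => i j; rewrite /curvature !mx_linE; ring. Qed.

(** Torsion-freeness holds on an open set and can be differentiated. *)
Lemma derive_connection_sym x u v w : O x ->
  'D_u (fun y => C y v) x *m w = 'D_u (fun y => C y w) x *m v.
Proof.
move=> Ox; rewrite -(derive_mulmx_cst w (@derivable_C x v u Ox)).
rewrite -(derive_mulmx_cst v (@derivable_C x w u Ox)).
by apply: (derive_on openO _ Ox) => y Oy; apply: torsionfree.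
Qed.

Lemma first_bianchi x u v w : O x ->
  K x u v *m w + K x v w *m u + K x w u *m v = 0.
Proof.
move=> Ox; rewrite /curvature.
move: (derive_connection_sym u v w Ox) (derive_connection_sym v w u Ox) (derive_connection_sym w u v Ox).
generalize ('D_u (fun y => C y v) x) ('D_v (fun y => C y u) x)
  ('D_v (fun y => C y w) x) ('D_w (fun y => C y v) x)
  ('D_w (fun y => C y u) x) ('D_u (fun y => C y w) x) => d1 d2 d3 d4 d5 d6 e1 e2 e3.
rewrite !mx_expand e1 e2 e3.
rewrite (torsionfree v w Ox) (torsionfree w u Ox) (torsionfree u v Ox).
generalize (C x u) (C x v) (C x w) => a b c.
by mx_ring.
Qed.

Lemma curvature_subl x u v w : (forall y u v, O y -> C y (u - v) = C y u - C y v) ->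
  O x -> K x (u - v) w = K x u w - K x v w.
Proof.
move=> Csub Ox.
have e1 : 'D_(u - v) (fun y => C y w) x = 'D_u (fun y => C y w) x - 'D_v (fun y => C y w) x.
  have df : differentiable (fun y => C y w) x.
    exact: (smooth_differentiable (smoothC w) Ox).
  by rewrite (_ : u - v = (-1) *: v + u) ?derive_dirZD // scaleN1r addrC.
have e2 : 'D_w (fun y => C y (u - v)) x = 'D_w (fun y => C y u) x - 'D_w (fun y => C y v) x.
  rewrite -(derive_sub (@derivable_C x u w Ox) (@derivable_C x v w Ox)).
  exact: (derive_on openO w Ox (fun y => Csub y u v)).
rewrite /curvature e1 e2 (Csub _ _ _ Ox).
generalize ('D_u (fun y => C y w) x) ('D_v (fun y => C y w) x)
  ('D_w (fun y => C y u) x) ('D_w (fun y => C y v) x) (C x u) (C x v) (C x w).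
move=> d1 d2 d3 d4 a b c.
by mx_ring.
Qed.

Lemma derive_curvature x u v w : O x ->
  'D_u (fun y => K y v w) x =
    'D_u (fun y => 'D_v (fun z => C z w) y) x - 'D_u (fun y => 'D_w (fun z => C z v) y) x
    + ('D_u (fun y => C y v) x *m C x w + C x v *m 'D_u (fun y => C y w) x)
    - ('D_u (fun y => C y w) x *m C x v + C x w *m 'D_u (fun y => C y v) x).
Proof.
move=> Ox.
have s1 a b : smooth_on O (fun y => 'D_a (fun z => C z b) y) by apply: smooth_derive.
have s2 a b : smooth_on O (fun y => C y a *m C y b) by apply: smooth_mulmx.
have sB (f g : 'cV[R]_m -> 'M[R]_m) : smooth_on O f -> smooth_on O g ->
    smooth_on O (fun y => f y - g y).
  by move=> sf sg; apply: smoothD => //; apply: smoothN.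
have dd f (sf : smooth_on O f) : derivable (f : 'cV[R]_m -> 'M[R]_m) x u.
  exact: (smooth_derivable sf Ox).
rewrite /curvature derive_sub; [|by apply: dd; apply: smoothD => //; apply: sB|exact: dd].
rewrite derive_add; [|by apply: dd; apply: sB|exact: dd].
rewrite derive_sub; [|exact: dd|exact: dd].
by rewrite !derive_mulmx; try exact: derivable_C.
Qed.

(** The second Bianchi identity once derivatives are replaced by letters: a, b, c
    stand for C_u, C_v, C_w, two-letter names for their first derivatives, s1, s2,
    s3 for the second derivatives that are left once their symmetry is used, and
    k1, k2, k3 for the curvature terms with a differentiated argument. *)
Lemma bianchi_cancellation (a b c ab ba bc cb ca ac s1 s2 s3 k1 k2 k3 : 'M[R]_m) :
  let K cu cv duv dvu : 'M[R]_m := duv - dvu + cu *m cv - cv *m cu in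
  let N s s' cu cv cw duv duw dvw dwv k k' : 'M[R]_m :=
    s - s' + (duv *m cw + cv *m duw) - (duw *m cv + cw *m duv)
    + cu *m K cv cw dvw dwv - K cv cw dvw dwv *m cu - k - k' in
  N s1 s2 a b c ab ac bc cb (- k1) k2 + N s3 s1 b c a bc ba ca ac (- k3) k1
  + N s2 s3 c a b ca cb ab ba (- k2) k3 = 0.
Proof. by move=> K' N; rewrite /N /K'; mx_ring. Qed.

Lemma second_bianchi x u v w : O x ->
  nabla_end2 C K u x v w + nabla_end2 C K v x w u + nabla_end2 C K w x u v = 0.
Proof.
move=> Ox; rewrite /nabla_end2 /nabla_end !derive_curvature //.
rewrite (schwarz openO u v (smoothC w) Ox) (schwarz openO v w (smoothC u) Ox).
rewrite (schwarz openO w u (smoothC v) Ox).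
rewrite (torsionfree u v Ox) (torsionfree w u Ox) (torsionfree v w Ox).
rewrite (curvature_anti x (C x v *m u) w) (curvature_anti x (C x u *m w) v).
rewrite (curvature_anti x (C x w *m v) u).
exact: bianchi_cancellation.
Qed.
End Curvature.


(** * Ricci identities *)

Section RicciIdentities.
Variables (R : realType) (m : nat) (O : set 'cV[R]_m).
Variable C : 'cV[R]_m -> 'cV[R]_m -> 'M[R]_m.
Hypotheses (openO : open O).
Hypothesis smoothC : forall u, smooth_on O (fun x => C x u).
Local Notation K := (curvature C).
Implicit Types (u v w : 'cV[R]_m).

Let derivable_C x u v : O x -> derivable (fun y => C y u) x v.
Proof. by move=> Ox; apply: (smooth_derivable (smoothC u) Ox). Qed.

(** Here a and b are C_u and C_v, ab and ba the derivatives of C_v along u and of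
    C_u along v, and dd the second derivative of the metric: its symmetry makes the
    curvature skew. *)
Lemma skew_cancellation (G a b ab ba : 'M[R]_m) :
  let dd cu cv duv : 'M[R]_m := duv^T *m G + cv^T *m (cu^T *m G + G *m cu)
     + ((cu^T *m G + G *m cu) *m cv + G *m duv) in
  dd a b ab = dd b a ba ->
  (ab - ba + a *m b - b *m a)^T *m G + G *m (ab - ba + a *m b - b *m a) = 0.
Proof.
move=> dd e; have {e} : dd a b ab - dd b a ba = 0 by rewrite e subrr.
have trD (X Y : 'M[R]_m) : (X + Y)^T = X^T + Y^T by apply: linearD.
have trN (X : 'M[R]_m) : (- X)^T = - X^T by apply: linearN.
have trM (X Y : 'M[R]_m) : (X *m Y)^T = Y^T *m X^T by apply: trmx_mul.
move=> e; rewrite -[RHS]e /dd !(trD, trN, trM).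
by mx_ring.
Qed.

Lemma curvature_skew (G : 'cV[R]_m -> 'M[R]_m) x u v : smooth_on O G ->
  (forall y w, O y -> 'D_w G y = (C y w)^T *m G y + G y *m C y w) -> O x ->
  (K x u v)^T *m G x + G x *m K x u v = 0.
Proof.
move=> sG metric Ox; apply: skew_cancellation.
have derivable_G w : derivable G x w by apply: (smooth_derivable sG Ox).
have dGw a b : 'D_a (fun y => 'D_b G y) x =
  ('D_a (fun y => C y b) x)^T *m G x + (C x b)^T *m ((C x a)^T *m G x + G x *m C x a)
  + (((C x a)^T *m G x + G x *m C x a) *m C x b + G x *m 'D_a (fun y => C y b) x).
  have dCt := derivable_trmx (@derivable_C x b a Ox).
  rewrite (derive_on openO a Ox (fun y Oy => metric y b Oy)).
  have dCb := @derivable_C x b a Ox.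
  rewrite (derive_add (derivable_mulmx dCt (derivable_G a))
    (derivable_mulmx (derivable_G a) dCb)).
  rewrite (derive_mulmx dCt (derivable_G a)) (derive_mulmx (derivable_G a) (@derivable_C x b a Ox)).
  by rewrite (derive_trmx (@derivable_C x b a Ox)) (metric x a Ox).
rewrite -(dGw u v) -(dGw v u); exact: (schwarz openO u v sG Ox).
Qed.

Lemma commutator_cancellation p (a b ab ba : 'M[R]_m) (A Au Av s : 'M[R]_(m, p)) :
  (s + (ab *m A + b *m Au) + a *m (Av + b *m A))
  - (s + (ba *m A + a *m Av) + b *m (Au + a *m A))
  = (ab - ba + a *m b - b *m a) *m A.
Proof. by mx_ring. Qed.

Lemma ricci_identity (X : 'cV[R]_m -> 'cV[R]_m) x u v :
  smooth_on O X -> O x ->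
  let N w y := 'D_w X y + C y w *m X y in
  K x u v *m X x = ('D_u (N v) x + C x u *m N v x) - ('D_v (N u) x + C x v *m N u x).
Proof.
move=> sX Ox N.
have dN a b : 'D_a (N b) x = 'D_a (fun y => 'D_b X y) x
    + ('D_a (fun y => C y b) x *m X x + C x b *m 'D_a X x).
  have dX : derivable X x a by apply: (smooth_derivable sX Ox).
  rewrite /N (derive_add (smooth_derivable (smooth_derive b sX) Ox)).
    by rewrite (derive_mulmx (@derivable_C x b a Ox) dX).
  exact: (derivable_mulmx (@derivable_C x b a Ox) dX).
rewrite !dN (schwarz openO u v sX Ox).
exact/esym/commutator_cancellation.
Qed.

Lemma commutator_end_cancellation (a b ab ba A Au Av s : 'M[R]_m) :
  let N c Du := Du + c *m A - A *m c : 'M[R]_m in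
  (s + (ab *m A + b *m Au) - (Au *m b + A *m ab) + a *m N b Av - N b Av *m a)
  - (s + (ba *m A + a *m Av) - (Av *m a + A *m ba) + b *m N a Au - N a Au *m b)
  = (ab - ba + a *m b - b *m a) *m A - A *m (ab - ba + a *m b - b *m a).
Proof. by move=> N; rewrite /N; mx_ring. Qed.

Lemma ricci_identity_end (A : 'cV[R]_m -> 'M[R]_m) x u v :
  smooth_on O A -> O x ->
  K x u v *m A x - A x *m K x u v =
  nabla_end C (nabla_end C A v) u x - nabla_end C (nabla_end C A u) v x.
Proof.
move=> sA Ox.
have dN a b : 'D_a (nabla_end C A b) x = 'D_a (fun y => 'D_b A y) x
    + ('D_a (fun y => C y b) x *m A x + C x b *m 'D_a A x)
    - ('D_a A x *m C x b + A x *m 'D_a (fun y => C y b) x).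
  have dA : derivable A x a by apply: (smooth_derivable sA Ox).
  have s1 : smooth_on O (fun y => C y b *m A y) by apply: smooth_mulmx.
  have s2 : smooth_on O (fun y => A y *m C y b) by apply: smooth_mulmx.
  have s3 : smooth_on O (fun y => 'D_b A y) by apply: smooth_derive.
  have s4 := smoothD openO s3 s1.
  rewrite /nabla_end (derive_sub (smooth_derivable s4 Ox) (smooth_derivable s2 Ox)).
  rewrite (derive_add (smooth_derivable s3 Ox) (smooth_derivable s1 Ox)).
  by rewrite (derive_mulmx (@derivable_C x b a Ox) dA) (derive_mulmx dA (@derivable_C x b a Ox)).
rewrite [in RHS]/nabla_end !dN (schwarz openO u v sA Ox).
exact/esym/commutator_end_cancellation.
Qed.

Lemma smooth_nabla_end (A : 'cV[R]_m -> 'M[R]_m) u :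
  smooth_on O A -> smooth_on O (nabla_end C A u).
Proof.
move=> sA; apply: smoothD => //; last first.
  by apply: smoothN => //; apply: smooth_mulmx.
by apply: smoothD; [|apply: smooth_derive|apply: smooth_mulmx].
Qed.

End RicciIdentities.

(** * Quaternionic frames *)

Section Pairing.
Variables (R : realType) (m : nat) (B : 'M[R]_m).
Hypotheses (symB : B^T = B) (unitB : B \in unitmx).
Implicit Types (u v w : 'cV[R]_m).

Lemma pairingC u v : pairing B u v = pairing B v u.
Proof.
rewrite /pairing.
have -> : u^T *m B *m v = (v^T *m B *m u)^T by rewrite !trmx_mul trmxK symB mulmxA.
by rewrite mxE.
Qed.

Lemma pairing_lin a u v w : pairing B (a *: u + v) w = a * pairing B u w + pairing B v w.
Proof.
rewrite /pairing (_ : trmx _ = a *: u^T + v^T); last exact: linearP.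
by rewrite !mx_expand !mx_linE.
Qed.

Lemma pairing_skew (A : 'M[R]_m) u v : A^T *m B = - (B *m A) ->
  pairing B (A *m u) v = - pairing B u (A *m v).
Proof.
move=> sA; rewrite /pairing trmx_mul -[_ *m A^T *m B]mulmxA sA.
by rewrite !mx_expand !mx_linE.
Qed.

Lemma pairing_eq0 u : (forall v, pairing B u v = 0) -> u = 0.
Proof.
move=> h; have : B *m u = 0.
  apply/matrixP => i j; rewrite ord1 [RHS]mxE.
  have := h (delta_mx i 0); rewrite pairingC /pairing trmx_delta.
  by rewrite -mulmxA -rowE [X in X = _]mxE.
by move=> e; rewrite -[u](mulKmx unitB) e mulmx0.
Qed.

Lemma pairing_neq0 u : u != 0 -> exists v, pairing B u v != 0.
Proof.
move=> u0; apply: contrapT => h; move/eqP: u0; apply; apply: pairing_eq0 => v.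
by apply: contrapT => /eqP uv; apply: h; exists v.
Qed.

End Pairing.

Lemma sum_ord3 (V : nmodType) (f : 'I_3 -> V) : \sum_a f a = f 0 + f 1 + f 2.
Proof.
rewrite !big_ord_recl big_ord0 addr0 addrA.
by congr (f _ + f _ + f _); apply: val_inj.
Qed.

Lemma forall_ord3 (P : 'I_3 -> Prop) : P 0 -> P 1 -> P 2 -> forall a, P a.
Proof.
move=> p0 p1 p2 [[|[|[|//]]] i].
- by rewrite (_ : Ordinal i = 0) //; apply: val_inj.
- by rewrite (_ : Ordinal i = 1) //; apply: val_inj.
- by rewrite (_ : Ordinal i = 2) //; apply: val_inj.
Qed.

Section Quaternionic.
Variables (R : realType) (m : nat) (J : 'I_3 -> 'M[R]_m).
Hypothesis qJ : quaternionic J.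

Lemma quaternionic_products :
  [/\ J 0 *m J 1 = J 2, J 1 *m J 2 = J 0 & J 2 *m J 0 = J 1] /\
  [/\ J 1 *m J 0 = - J 2, J 2 *m J 1 = - J 0 & J 0 *m J 2 = - J 1].
Proof.
have [sq IJ] := qJ.
have IIA A : J 0 *m (J 0 *m A) = - A by rewrite mulmxA sq mulNmx mul1mx.
have JJA A : A *m J 1 *m J 1 = - A by rewrite -mulmxA sq mulmxN mulmx1.
have IK : J 0 *m J 2 = - J 1 by rewrite -IJ IIA.
have KJ : J 2 *m J 1 = - J 0 by rewrite -IJ JJA.
have JIJ : J 1 *m J 0 *m J 1 = J 0.
  have := congr1 (fun A => J 0 *m A) (sq 2).
  rewrite -{1 2}IJ -!mulmxA IIA mulmxN mulmx1 => /oppr_inj.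
  by rewrite mulmxA.
have JI : J 1 *m J 0 = - J 2.
  by have := JJA _ (J 1 *m J 0); rewrite JIJ IJ => ->; rewrite opprK.
split; split=> //.
- by rewrite -IJ mulmxA.
- by rewrite -IJ -mulmxA JI mulmxN IK opprK.
Qed.

Lemma quaternionic_anticommute a b :
  J a *m J b + J b *m J a = (- 2 * (a == b)%:R)%:M.
Proof.
have [sq _] := qJ; have [[e1 e2 e3] [f1 f2 f3]] := quaternionic_products.
have [<-|ab] := eqVneq a b.
  rewrite !sq; apply/matrixP => i j; rewrite !mx_linE [RHS]mxE mxE.
  by case: (i == j); rewrite ?mulr1n ?mulr0n; ring.
rewrite mulr0 raddf0.
move: a b ab; apply: forall_ord3; apply: forall_ord3 => //= _.
all: by rewrite ?(e1, e2, e3, f1, f2, f3) ?subrr ?addNr.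
Qed.

End Quaternionic.

Section Sp1.
Variables (R : realType) (m : nat) (J : 'I_3 -> 'M[R]_m).
Hypotheses (qJ : quaternionic J) (m_gt0 : (0 < m)%N).

(** The span of the J_a is so(3) acting on itself: differentiating the constant
    anticommutators of the frame gives antisymmetric coefficients.  D is either a
    covariant derivative of the frame or its commutator with the curvature. *)
Lemma sp1_antisymmetric (D : 'I_3 -> 'M[R]_m) (t : 'I_3 -> 'I_3 -> R) :
  (forall a, D a = \sum_b t a b *: J b) ->
  (forall a b, D a *m J b + J a *m D b + D b *m J a + J b *m D a = 0) ->
  forall a b, t a b = - t b a.
Proof.
move=> Dt Dleib a b.
have ac := quaternionic_anticommute qJ.
have half c d : D c *m J d + J d *m D c = (-2 * t c d)%:M.
  rewrite Dt mulmx_suml mulmx_sumr -big_split (bigD1 d) //= big1 => [|e ed].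
    rewrite -scalemxAl -scalemxAr -scalerDr ac eqxx addr0 -scalemx1 scalerA scalemx1.
    by congr (_%:M); rewrite mulr1; ring.
  by rewrite -scalemxAl -scalemxAr -scalerDr ac (negPf ed) mulr0 -scalemx1 scalerA mulr0 scale0r.
have h : (-2 * t a b)%:M + (-2 * t b a)%:M = 0 :> 'M[R]_m.
  rewrite -!half -[RHS](Dleib a b).
  by apply/matrixP => i j; rewrite !mx_linE; ring.
have := congr1 (fun A : 'M[R]_m => A (Ordinal m_gt0) (Ordinal m_gt0)) h.
rewrite !mxE eqxx !mulr1n; lra.
Qed.
End Sp1.


Section PairingRight.
Variables (R : realType) (m : nat) (B : 'M[R]_m).
Implicit Types (u v w : 'cV[R]_m).
Lemma pairingDr u v w : pairing B w (u + v) = pairing B w u + pairing B w v.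
Proof. by rewrite /pairing !mx_expand !mx_linE. Qed.
Lemma pairingNr u w : pairing B w (- u) = - pairing B w u.
Proof. by rewrite /pairing !mx_expand !mx_linE. Qed.
Lemma pairingZr a u w : pairing B w (a *: u) = a * pairing B w u.
Proof. by rewrite /pairing !mx_expand !mx_linE. Qed.

(** The trace of the rank one map u -> <u,w> z. *)
Lemma pairing_contract (z : 'cV[R]_m) w :
  \sum_i pairing B (delta_mx i 0) w * z i 0 = pairing B z w.
Proof.
have -> : pairing B z w = (z^T *m (B *m w)) 0 0 by rewrite /pairing mulmxA.
rewrite mxE; apply: eq_bigr => i _; rewrite mulrC [(trmx _) _ _]mxE; congr (_ * _).
by rewrite /pairing trmx_delta -mulmxA -rowE mxE.
Qed.

(** The symmetry of the second covariant derivative of xi, in letters.  The vectors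
    e0, .., e3 are xi and the J_a xi; N0, .., N3 are their covariant derivatives in
    the direction w, the c_i being the coefficients of nabla_w J_a; s_i stands for
    <C_u v,e_i>, which is symmetric in u and v; and T is the covariant derivative
    of <v,e> e. *)
Lemma radial_cancellation u v (e0 e1 e2 e3 : 'cV[R]_m)
   (a1 a2 a3 b1 b2 b3 s0 s1 s2 s3 : R) :
  let p w e := pairing B w e in
  let N0 w := p w e0 *: e0 - p w e1 *: e1 - p w e2 *: e2 - p w e3 *: e3 in
  let N1 w c2 c3 := c3 *: e2 - c2 *: e3
     + (p w e0 *: e1 + p w e1 *: e0 - p w e2 *: e3 + p w e3 *: e2) in
  let N2 w c1 c3 := c1 *: e3 - c3 *: e1
     + (p w e0 *: e2 + p w e2 *: e0 - p w e3 *: e1 + p w e1 *: e3) in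
  let N3 w c1 c2 := c2 *: e1 - c1 *: e2
     + (p w e0 *: e3 + p w e3 *: e0 - p w e1 *: e2 + p w e2 *: e1) in
  let T w s N e := p w e *: N + (s + p w N) *: e in
  (T v s0 (N0 u) e0 - T v s1 (N1 u a2 a3) e1
   - T v s2 (N2 u a1 a3) e2 - T v s3 (N3 u a1 a2) e3)
  = (T u s0 (N0 v) e0 - T u s1 (N1 v b2 b3) e1
   - T u s2 (N2 v b1 b3) e2 - T u s3 (N3 v b1 b2) e3).
Proof.
move=> p N0 N1 N2 N3 T; rewrite /T /N0 /N1 /N2 /N3 /p.
rewrite !(pairingDr, pairingNr, pairingZr).
by apply/matrixP => i j; rewrite !mx_linE; ring.
Qed.
End PairingRight.

(** * Structures of linear type near a point *)

Section Frame.
Variables (R : realType) (m : nat) (O : set 'cV[R]_m) (G : 'cV[R]_m -> 'M[R]_m).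
Variables (J : 'I_3 -> 'cV[R]_m -> 'M[R]_m) (xi : 'cV[R]_m -> 'cV[R]_m).
Variables (S : 'cV[R]_m -> 'cV[R]_m -> 'M[R]_m).
Implicit Types (u v w x : 'cV[R]_m).
Local Notation C := (levi_civita G).
Local Notation Ct := (fun x u => C x u - S x u).
Hypotheses (m_gt0 : (0 < m)%N) (openO : open O).
Hypothesis smoothG : smooth_on O G.
Hypothesis symG : forall x, O x -> (G x)^T = G x.
Hypothesis unitG : forall x, O x -> G x \in unitmx.
Hypothesis smoothJ : forall a, smooth_on O (J a).
Hypothesis quatJ : forall x, O x -> quaternionic (fun a => J a x).
Hypothesis skewJ : forall x, O x -> forall a, (J a x)^T *m G x = - (G x *m J a x).
Hypothesis parJ : forall A, smooth_on O A ->
  (forall x, O x -> span3 (fun a => J a x) (A x)) ->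
  forall x, O x -> forall u, span3 (fun a => J a x) (nabla_end C A u x).
Hypothesis smoothS : forall u, smooth_on O (fun x => S x u).
Hypothesis linS : forall x, O x -> forall (t : R) u v,
  S x (t *: u + v) = t *: S x u + S x v.
Hypothesis smooth_xi : smooth_on O xi.
Hypothesis xi_neq0 : forall x, O x -> xi x != 0.
Hypothesis xi_null : forall x, O x -> pairing (G x) (xi x) (xi x) = 0.
Hypothesis S_def : forall x, O x -> forall u v,
  S x u *m v = linear_type_rhs (G x) (fun a => J a x) (xi x) (fun=> 0) u v.
Hypothesis metricS : forall x, O x -> forall u, nabla_bilin Ct G u x = 0.
Hypothesis parallelR : forall x, O x -> forall u v w,
  nabla_end2 Ct (curvature C) u x v w = 0.
Hypothesis parallelS : forall x, O x -> forall u v, nabla_end1 Ct S u x v = 0.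

Lemma S_expand x u v : O x ->
  S x u *m v = pairing (G x) u v *: xi x - pairing (G x) v (xi x) *: u
  + (pairing (G x) (J 0 x *m v) (xi x) *: (J 0 x *m u)
       - pairing (G x) u (J 0 x *m v) *: (J 0 x *m xi x)
   + (pairing (G x) (J 1 x *m v) (xi x) *: (J 1 x *m u)
       - pairing (G x) u (J 1 x *m v) *: (J 1 x *m xi x))
   + (pairing (G x) (J 2 x *m v) (xi x) *: (J 2 x *m u)
       - pairing (G x) u (J 2 x *m v) *: (J 2 x *m xi x))).
Proof.
move=> Ox; rewrite S_def // /linear_type_rhs sum_ord3 [X in _ + X]big1 ?addr0 // => a _.
by rewrite /pairing mulmx0 [X in X *: _]mxE scale0r.
Qed.

Lemma metric_S x u : O x -> (S x u)^T *m G x = - (G x *m S x u).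
Proof.
move=> Ox; apply/eqP; rewrite -subr_eq0 opprK; apply/eqP.
have := metricS Ox u; rewrite /nabla_bilin (connection_metric openO smoothG symG unitG u Ox).
have -> : (C x u - S x u)^T = (C x u)^T - (S x u)^T by apply: linearB.
generalize (C x u) (S x u)^T (S x u) => a b c e.
rewrite -[RHS]e.
by mx_ring.
Qed.

Lemma trace_J x a : O x -> \sum_i (J a x *m (delta_mx i 0 : 'cV[R]_m)) i 0 = 0.
Proof.
move=> Ox; have -> : \sum_i (J a x *m (delta_mx i 0 : 'cV[R]_m)) i 0 = \tr (J a x).
  by apply: eq_bigr => i _; rewrite -(colE i (J a x)) [LHS]mxE.
have [[e1 e2 e3] [f1 f2 f3]] := quaternionic_products (quatJ Ox).
have h A B D : A *m B = D -> B *m A = - D -> \tr D = 0 :> R.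
  move=> <- e; have := mxtrace_mulC A B; rewrite e raddfN /=; lra.
by move: a; apply: forall_ord3; [apply: h e2 f2|apply: h e3 f3|apply: h e1 f1].
Qed.

(** The four kinds of terms of S contribute 1, -m, 0 and -3 times <w,xi>: the frame
    is traceless, and <J_a xi,J_a w> = <xi,w>. *)
Lemma S_contract x w : O x ->
  \sum_i (S x (delta_mx i 0) *m w) i 0 = - (m%:R + 2) * pairing (G x) w (xi x).
Proof.
move=> Ox.
have dd : \sum_(i < m) (delta_mx i 0 : 'cV[R]_m) i 0 = m%:R.
  under eq_bigr => i _ do rewrite mxE !eqxx.
  by rewrite sumr_const card_ord.
have JJ a : pairing (G x) (J a x *m xi x) (J a x *m w) = pairing (G x) w (xi x).
  rewrite pairing_skew; last exact: skewJ.
  by rewrite mulmxA (quatJ Ox).1 mulNmx mul1mx pairingNr opprK pairingC // symG.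
under eq_bigr => i _ do rewrite S_expand // !mx_linE.
rewrite !(big_split, sumrN) /=.
rewrite -!mulr_sumr !trace_J // dd !pairing_contract !JJ.
rewrite (pairingC _ (xi x)) ?symG //; ring.
Qed.

(** The trace of X -> S_X is natural, so the action of A on S passes to it; here
    stated as the cancellation of the two terms in which A touches the contracted
    slots. *)
Lemma S_contract_commutes x (A : 'M[R]_m) w : O x ->
  \sum_i (S x (A *m delta_mx i 0) *m w) i 0 =
  \sum_i (A *m (S x (delta_mx i 0) *m w)) i 0.
Proof.
move=> Ox.
have S0 : S x 0 = 0.
  have := linS Ox 1 0 0; rewrite scaler0 addr0 scale1r => e.
  by apply: (addrI (S x 0)); rewrite addr0 -e.
have S_sum (c : 'I_m -> R) (r : seq 'I_m) :
    S x (\sum_(k <- r) c k *: delta_mx k 0) = \sum_(k <- r) c k *: S x (delta_mx k 0).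
  elim: r => [|k r IH]; first by rewrite !big_nil.
  by rewrite !big_cons linS // IH.
transitivity (\sum_i \sum_k A k i * (S x (delta_mx k 0) *m w) i 0).
  apply: eq_bigr => i _.
  have -> : A *m delta_mx i 0 = \sum_k A k i *: (delta_mx k 0 : 'cV[R]_m).
    rewrite -colE [LHS]matrix_sum_delta.
    by apply: eq_bigr => k _; rewrite big_ord1 [X in X *: _]mxE.
  by rewrite S_sum mulmx_suml summxE; apply: eq_bigr => k _; rewrite mxZl mx_linE.
rewrite exchange_big; apply: eq_bigr => k _.
by rewrite [RHS]mxE.
Qed.

(** Contracting nabla~ S = 0 shows that the 1-form <.,xi> is nabla~-parallel, since
    it is proportional to the trace of S; as nabla~ g = 0 and g is nondegenerate,
    xi itself is nabla~-parallel. *)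
Lemma nabla_xi x u : O x -> 'D_u xi x + C x u *m xi x = S x u *m xi x.
Proof.
move=> Ox.
pose A := C x u - S x u.
have derivable_G : derivable G x u by apply: (smooth_derivable smoothG Ox).
have dxi : derivable xi x u by apply: (smooth_derivable smooth_xi Ox).
have dS v : 'D_u (fun y => S y v) x = S x v *m A + S x (A *m v) - A *m S x v.
  have e (d a b c : 'M[R]_m) : d + c - a - b = 0 -> d = a + b - c.
    move=> h; rewrite -[LHS]subr0 -h.
    by apply/matrixP => i j; rewrite !mx_linE; ring.
  exact: e (parallelS Ox u v).
have dGA : 'D_u G x = A^T *m G x + G x *m A.
  have e (d a b : 'M[R]_m) : d - a - b = 0 -> d = a + b.
    by move=> h; rewrite -[LHS]subr0 -h; apply/matrixP => i j; rewrite !mx_linE; ring.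
  exact: e (metricS Ox u).
have weak w : (w^T *m G x *m ('D_u xi x + A *m xi x)) 0 0 = 0.
  pose f i := (fun y => (S y (delta_mx i 0) *m w) i 0 : R^o).
  have df i : derivable (fun y => S y (delta_mx i 0) *m w) x u.
    by apply: derivable_mulmx; [apply: (smooth_derivable (smoothS _) Ox)|apply: derivable_cst].
  have dtr : 'D_u (\sum_i f i) x = \sum_i (S x (delta_mx i 0) *m (A *m w)) i 0.
    rewrite derive_sum => [|i]; last exact: ((derivable_mxP _ _ _).1 (df i) i 0).
    have e i : 'D_u (f i) x = (S x (delta_mx i 0) *m (A *m w)) i 0
       + ((S x (A *m delta_mx i 0) *m w) i 0 - (A *m (S x (delta_mx i 0) *m w)) i 0).
      rewrite (derive_entry i 0 (df i)).
      rewrite (derive_mulmx_cst w (smooth_derivable (smoothS _) Ox)) dS.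
      by rewrite !mx_expand !mx_linE -addrA.
    under eq_bigr => i _ do rewrite e.
    by rewrite big_split sumrB /= (S_contract_commutes A w Ox) subrr addr0.
  have dGxi := derivable_mulmx derivable_G dxi.
  have dP : derivable (fun y => w^T *m (G y *m xi y)) x u.
    by apply: derivable_mulmx => //; apply: derivable_cst.
  have dpair : 'D_u (fun y => (w^T *m (G y *m xi y)) 0 0 : R^o) x =
      (w^T *m ('D_u G x *m xi x + G x *m 'D_u xi x)) 0 0.
    rewrite (derive_entry 0 0 dP) (derive_cst_mulmx w^T dGxi).
    by rewrite (derive_mulmx derivable_G dxi).
  have c0 : - (m%:R + 2) != 0 :> R.
    by rewrite oppr_eq0 gt_eqF // ltr_wpDl.
  have fE y : O y -> (\sum_i f i) y =
      (- (m%:R + 2)) *: ((w^T *m (G y *m xi y)) 0 0 : R^o).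
    by move=> Oy; rewrite fct_sumE (S_contract w Oy) /pairing mulmxA.
  have : - (m%:R + 2) * 'D_u (fun y => (w^T *m (G y *m xi y)) 0 0 : R^o) x =
     - (m%:R + 2) * pairing (G x) (A *m w) (xi x).
    rewrite -(S_contract _ Ox) -dtr (derive_on openO u Ox fE).
    by rewrite deriveZ //; exact: ((derivable_mxP _ _ _).1 dP 0 0).
  move=> /(mulfI c0); rewrite dpair dGA /pairing trmx_mul => e.
  have := e; rewrite !mx_expand !mx_linE => {}e.
  by lra.
have : 'D_u xi x + A *m xi x = 0.
  apply: (pairing_eq0 (symG Ox) (unitG Ox)) => w.
  by rewrite pairingC ?symG //; apply: weak.
rewrite /A; generalize ('D_u xi x) (C x u) (S x u) => d a b h.
rewrite -[RHS]add0r -h.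
by mx_ring.
Qed.

Let smoothC u : smooth_on O (fun x => C x u).
Proof. exact: connection_smooth. Qed.

Let torsionfree x u v : O x -> C x u *m v = C x v *m u.
Proof. by move=> Ox; apply: (connection_torsionfree openO smoothG symG unitG). Qed.

Let metric x u : O x -> 'D_u G x = (C x u)^T *m G x + G x *m C x u.
Proof. by move=> Ox; apply: (connection_metric openO smoothG symG unitG). Qed.

Lemma nabla_J_span x u a : O x -> span3 (fun a => J a x) (nabla_end C (J a) u x).
Proof.
move=> Ox; apply: parJ => // y Oy.
exists (fun b => (b == a)%:R); rewrite (bigD1 a) //= eqxx scale1r.
by rewrite big1 ?addr0 // => b /negPf ->; rewrite scale0r.
Qed.

(** The connection matrix of the parallel subbundle in the frame J_a. *)
Lemma nabla_J x u : O x -> exists a b c : R,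
  [/\ nabla_end C (J 0) u x = c *: J 1 x - b *: J 2 x,
      nabla_end C (J 1) u x = a *: J 2 x - c *: J 0 x
    & nabla_end C (J 2) u x = b *: J 0 x - a *: J 1 x].
Proof.
move=> Ox; have /choice [t Dt] := fun a => nabla_J_span u a Ox.
have anti a b : t a b = - t b a.
  apply: (sp1_antisymmetric (quatJ Ox) m_gt0 Dt) => {}a {}b.
  have e y : O y -> J a y *m J b y + J b y *m J a y = (-2 * (a == b)%:R)%:M.
    by move=> Oy; apply: (quaternionic_anticommute (quatJ Oy)).
  have sab c d : smooth_on O (fun y => J c y *m J d y) by apply: smooth_mulmx.
  have E : nabla_end C (fun y => J a y *m J b y + J b y *m J a y) u x = 0.
    rewrite /nabla_end (derive_on openO u Ox e) derive_cst (e x Ox).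
    by rewrite scalar_mxC add0r subrr.
  rewrite -[RHS]E /nabla_end.
  rewrite (derive_add (smooth_derivable (sab a b) Ox) (smooth_derivable (sab b a) Ox)).
  rewrite !(derive_mulmx (smooth_derivable (smoothJ _) Ox) (smooth_derivable (smoothJ _) Ox)).
  generalize ('D_u (J a) x) ('D_u (J b) x) (J a x) (J b x) (C x u) => da db A B D.
  by mx_ring.
have t0 a : t a a = 0 by have := anti a a; lra.
exists (t 1 2), (t 2 0), (t 0 1); rewrite !Dt !sum_ord3 !t0 !scale0r.
rewrite (anti 0 2) (anti 1 0) (anti 2 1) !scaleNr.
by split; apply/matrixP => i j; rewrite !mx_linE; ring.
Qed.

Lemma derive_rank_one (Z : 'cV[R]_m -> 'cV[R]_m) x u v :
  smooth_on O Z -> O x ->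
  let N := 'D_u Z x + C x u *m Z x in
  'D_u (fun y => pairing (G y) v (Z y) *: Z y) x
    + C x u *m (pairing (G x) v (Z x) *: Z x)
  = pairing (G x) v (Z x) *: N
    + (pairing (G x) (C x u *m v) (Z x) + pairing (G x) v N) *: Z x.
Proof.
move=> sZ Ox N.
have e y : pairing (G y) v (Z y) *: Z y = Z y *m (v^T *m (G y *m Z y)).
  by rewrite [X in _ *m X]mx11_scalar mul_mx_scalar /pairing mulmxA.
have derivable_G : derivable G x u by apply: (smooth_derivable smoothG Ox).
have dZ : derivable Z x u by apply: (smooth_derivable sZ Ox).
have dGZ := derivable_mulmx derivable_G dZ.
have dP : derivable (fun y => v^T *m (G y *m Z y)) x u.
  by apply: derivable_mulmx => //; apply: derivable_cst.
under eq_fun do rewrite e.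
rewrite (derive_mulmx dZ dP) (derive_cst_mulmx v^T dGZ) (derive_mulmx derivable_G dZ) (metric u Ox).
have P11 (P : 'M[R]_1) (z : 'cV[R]_m) : z *m P = P 0 0 *: z.
  by rewrite [X in _ *m X]mx11_scalar mul_mx_scalar.
rewrite !P11 /N /pairing trmx_mul.
generalize ('D_u Z x) (Z x) (G x) (C x u) => d z g c.
rewrite !mx_expand !mx_linE.
by apply/matrixP => i j; rewrite !mx_linE; ring.
Qed.

Lemma pairing_Jxi_xi x : O x ->
  [/\ pairing (G x) (J 0 x *m xi x) (xi x) = 0, pairing (G x) (J 1 x *m xi x) (xi x) = 0
    & pairing (G x) (J 2 x *m xi x) (xi x) = 0].
Proof.
move=> Ox; have h a : pairing (G x) (J a x *m xi x) (xi x) = 0.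
  have := pairing_skew (xi x) (xi x) (skewJ Ox a).
  by rewrite [pairing _ (xi x) _]pairingC ?symG //; lra.
by rewrite !h.
Qed.

Lemma radial_S x u : O x ->
  let p e := pairing (G x) u e in
  let e0 := xi x in let e1 := J 0 x *m e0 in let e2 := J 1 x *m e0 in
  let e3 := J 2 x *m e0 in
  S x u *m xi x = p e0 *: e0 - p e1 *: e1 - p e2 *: e2 - p e3 *: e3.
Proof.
move=> Ox p e0 e1 e2 e3; rewrite S_expand // xi_null //.
have [-> -> ->] := pairing_Jxi_xi Ox.
rewrite -/(p _) -/e0 -/e1 -/e2 -/e3 /p.
by apply/matrixP => i j; rewrite !mx_linE; ring.
Qed.

(* The building block of S_w xi, with Z one of xi, J_1 xi, J_2 xi, J_3 xi. *)
Let W (Z : 'cV[R]_m -> 'cV[R]_m) w y : 'cV[R]_m := pairing (G y) w (Z y) *: Z y.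
Let xi_ a y : 'cV[R]_m := J a y *m xi y.

Let derivable_W Z w x u : smooth_on O Z -> O x -> derivable (W Z w) x u.
Proof.
move=> sZ Ox.
have e : W Z w = fun y => Z y *m (w^T *m (G y *m Z y)).
  apply/funext => y; rewrite /W [X in _ = _ *m X]mx11_scalar mul_mx_scalar.
  by rewrite /pairing mulmxA.
rewrite e; apply: derivable_mulmx; first exact: (smooth_derivable sZ Ox).
apply: derivable_mulmx; first exact: derivable_cst.
apply: derivable_mulmx; first exact: (smooth_derivable smoothG Ox).
exact: (smooth_derivable sZ Ox).
Qed.

Let smooth_xi_ a : smooth_on O (xi_ a).
Proof. exact: smooth_mulmx. Qed.

Let cov_W Z N x u w : smooth_on O Z -> O x -> 'D_u Z x + C x u *m Z x = N ->
  'D_u (W Z w) x + C x u *m W Z w x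
  = pairing (G x) w (Z x) *: N
    + (pairing (G x) (C x u *m w) (Z x) + pairing (G x) w N) *: Z x.
Proof. by move=> sZ Ox <-; apply: derive_rank_one. Qed.

Let cov_xi_ x u a : O x ->
  'D_u (xi_ a) x + C x u *m xi_ a x
  = nabla_end C (J a) u x *m xi x + J a x *m (S x u *m xi x).
Proof.
move=> Ox; rewrite -(nabla_xi u Ox) /xi_.
rewrite (derive_mulmx (smooth_derivable (smoothJ a) Ox) (smooth_derivable smooth_xi Ox)).
rewrite /nabla_end.
generalize ('D_u (J a) x) ('D_u xi x) (J a x) (C x u) (xi x) => d1 d2 A c z.
by mx_ring.
Qed.

(** By the Ricci identity, the antisymmetric part of the second covariant derivative
    of xi, whose first one is the combination of four W given by radial_S. *)
Lemma curvature_xi x u v : O x -> curvature C x u v *m xi x = 0.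
Proof.
move=> Ox; rewrite (ricci_identity openO smoothC u v smooth_xi Ox).
apply/eqP; rewrite subr_eq0; apply/eqP.
pose F w y := W xi w y - W (xi_ 0) w y - W (xi_ 1) w y - W (xi_ 2) w y.
have NE w y : O y -> 'D_w xi y + C y w *m xi y = F w y.
  by move=> Oy; rewrite nabla_xi // radial_S.
have DN a b : 'D_a (fun y => 'D_b xi y + C y b *m xi y) x
     + C x a *m ('D_b xi x + C x b *m xi x) =
   ('D_a (W xi b) x + C x a *m W xi b x)
   - ('D_a (W (xi_ 0) b) x + C x a *m W (xi_ 0) b x)
   - ('D_a (W (xi_ 1) b) x + C x a *m W (xi_ 1) b x)
   - ('D_a (W (xi_ 2) b) x + C x a *m W (xi_ 2) b x).
  rewrite (NE b x Ox) (derive_on openO a Ox (NE b)) /F.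
  have d := @derivable_W xi b x a smooth_xi Ox.
  have dI i := @derivable_W (xi_ i) b x a (smooth_xi_ i) Ox.
  have d1 := derivableB d (dI 0); have d2 := derivableB d1 (dI 1).
  rewrite (derive_sub d2 (dI 2)) (deriveB d1 (dI 1)) (deriveB d (dI 0)).
  generalize ('D_a (W xi b) x) ('D_a (W (xi_ 0) b) x) ('D_a (W (xi_ 1) b) x)
    ('D_a (W (xi_ 2) b) x) (W xi b x) (W (xi_ 0) b x) (W (xi_ 1) b x) (W (xi_ 2) b x) => *.
  by mx_ring.
have [[m1 m2 m3] [n1 n2 n3]] := quaternionic_products (quatJ Ox).
have sq a : J a x *m (J a x *m xi x) = - xi x.
  by rewrite mulmxA (quatJ Ox).1 mulNmx mul1mx.
pose e0 := xi x; pose e1 := xi_ 0 x; pose e2 := xi_ 1 x; pose e3 := xi_ 2 x.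
pose p w (e : 'cV[R]_m) := pairing (G x) w e.
pose N0 w := p w e0 *: e0 - p w e1 *: e1 - p w e2 *: e2 - p w e3 *: e3.
pose N1 w c2 c3 := c3 *: e2 - c2 *: e3
   + (p w e0 *: e1 + p w e1 *: e0 - p w e2 *: e3 + p w e3 *: e2).
pose N2 w c1 c3 := c1 *: e3 - c3 *: e1
   + (p w e0 *: e2 + p w e2 *: e0 - p w e3 *: e1 + p w e1 *: e3).
pose N3 w c1 c2 := c2 *: e1 - c1 *: e2
   + (p w e0 *: e3 + p w e3 *: e0 - p w e1 *: e2 + p w e2 *: e1).
pose T w (s : R) (N e : 'cV[R]_m) := p w e *: N + (s + p w N) *: e.
have JJ : [/\ J 0 x *m e1 = - e0, J 1 x *m e2 = - e0 & J 2 x *m e3 = - e0].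
  by rewrite !sq.
have JK : [/\ J 0 x *m e2 = e3, J 1 x *m e3 = e1 & J 2 x *m e1 = e2].
  by rewrite /e1 /e2 /e3 /xi_ !mulmxA m1 m2 m3.
have KJ : [/\ J 1 x *m e1 = - e3, J 2 x *m e2 = - e1 & J 0 x *m e3 = - e2].
  by rewrite /e1 /e2 /e3 /xi_ !mulmxA n1 n2 n3 !mulNmx.
have cov a b : exists c1 c2 c3 : R,
   'D_a (fun y => 'D_b xi y + C y b *m xi y) x + C x a *m ('D_b xi x + C x b *m xi x)
   = T b (p (C x a *m b) e0) (N0 a) e0 - T b (p (C x a *m b) e1) (N1 a c2 c3) e1
     - T b (p (C x a *m b) e2) (N2 a c1 c3) e2 - T b (p (C x a *m b) e3) (N3 a c1 c2) e3.
  have [c1 [c2 [c3 [h1 h2 h3]]]] := nabla_J a Ox.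
  exists c1, c2, c3; rewrite DN.
  have S0 : S x a *m xi x = N0 a by apply: radial_S.
  have C1 : 'D_a (xi_ 0) x + C x a *m xi_ 0 x = N1 a c2 c3.
    case: JJ JK KJ => j1 j2 j3 [k1 k2 k3] [l1 l2 l3].
    rewrite (cov_xi_ a 0 Ox) h1 S0 /N0 /N1 !mx_expand
      -[J 1 x *m xi x]/e2 -[J 2 x *m xi x]/e3 j1 k1 l3 -[J 0 x *m e0]/e1.
    by apply/matrixP => i j; rewrite !mx_linE; ring.
  have C2 : 'D_a (xi_ 1) x + C x a *m xi_ 1 x = N2 a c1 c3.
    case: JJ JK KJ => j1 j2 j3 [k1 k2 k3] [l1 l2 l3].
    rewrite (cov_xi_ a 1 Ox) h2 S0 /N0 /N2 !mx_expand
      -[J 0 x *m xi x]/e1 -[J 2 x *m xi x]/e3 j2 k2 l1 -[J 1 x *m e0]/e2.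
    by apply/matrixP => i j; rewrite !mx_linE; ring.
  have C3 : 'D_a (xi_ 2) x + C x a *m xi_ 2 x = N3 a c1 c2.
    case: JJ JK KJ => j1 j2 j3 [k1 k2 k3] [l1 l2 l3].
    rewrite (cov_xi_ a 2 Ox) h3 S0 /N0 /N3 !mx_expand
      -[J 0 x *m xi x]/e1 -[J 1 x *m xi x]/e2 j3 k3 l2 -[J 2 x *m e0]/e3.
    by apply/matrixP => i j; rewrite !mx_linE; ring.
  rewrite (cov_W b smooth_xi Ox (etrans (nabla_xi a Ox) S0)).
  rewrite (cov_W b (smooth_xi_ 0) Ox C1) (cov_W b (smooth_xi_ 1) Ox C2).
  by rewrite (cov_W b (smooth_xi_ 2) Ox C3).
have [a1 [a2 [a3 hu]]] := cov u v; have [b1 [b2 [b3 hv]]] := cov v u.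
etransitivity; first exact: hu.
etransitivity; last exact: esym hv.
rewrite (torsionfree v u Ox); exact: radial_cancellation.
Qed.
Lemma frame_triple x : O x ->
  quaternion_triple (pairing (G x)) (mulmx (J 0 x)) (mulmx (J 1 x)) (mulmx (J 2 x)).
Proof.
move=> Ox; have [[m1 m2 m3] [n1 n2 n3]] := quaternionic_products (quatJ Ox).
have sq a (z : 'cV[R]_m) : J a x *m (J a x *m z) = - z.
  by rewrite mulmxA (quatJ Ox).1 mulNmx mul1mx.
have sk a y z : pairing (G x) (J a x *m y) z = - pairing (G x) y (J a x *m z).
  by apply: pairing_skew; apply: skewJ.
by split=> // z; rewrite mulmxA ?m1 ?m2 ?m3 ?n1 ?n2 ?n3 ?mulNmx.
Qed.

(** By the Ricci identity for endomorphisms the commutator is a difference of second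
    covariant derivatives of J_a, and each stays in the parallel subbundle. *)
Lemma curvature_commutator x u v : O x -> exists abc : R * R * R,
  let K := curvature C x u v in
  [/\ K *m J 0 x - J 0 x *m K = abc.2 *: J 1 x - abc.1.2 *: J 2 x,
      K *m J 1 x - J 1 x *m K = abc.1.1 *: J 2 x - abc.2 *: J 0 x
    & K *m J 2 x - J 2 x *m K = abc.1.2 *: J 0 x - abc.1.1 *: J 1 x].
Proof.
move=> Ox; set K := curvature C x u v.
have sp a : span3 (fun a => J a x) (K *m J a x - J a x *m K).
  rewrite /K (ricci_identity_end openO smoothC u v (smoothJ a) Ox).
  have h w1 w2 : span3 (fun a => J a x) (nabla_end C (nabla_end C (J a) w1) w2 x).
    apply: parJ => // [|y Oy]; first exact: smooth_nabla_end.
    exact: nabla_J_span.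
  have [t ->] := h v u; have [t' ->] := h u v.
  by exists (fun b => t b - t' b); rewrite -sumrB; apply: eq_bigr => b _; rewrite scalerBl.
have /choice [t Dt] := sp.
have anti a b : t a b = - t b a.
  apply: (sp1_antisymmetric (quatJ Ox) m_gt0 Dt) => {}a {}b.
  have e : K *m (J a x *m J b x + J b x *m J a x) = (J a x *m J b x + J b x *m J a x) *m K.
    by rewrite (quaternionic_anticommute (quatJ Ox)) scalar_mxC.
  move/eqP: e; rewrite -subr_eq0 => /eqP e; rewrite -[RHS]e.
  generalize K (J a x) (J b x) => k A B.
  by mx_ring.
have t0 a : t a a = 0 by have := anti a a; lra.
exists (t 1 2, t 2 0, t 0 1); rewrite /= !Dt !sum_ord3 !t0 !scale0r.
rewrite (anti 0 2) (anti 1 0) (anti 2 1) !scaleNr.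
by split; apply/matrixP => i j; rewrite !mx_linE; ring.
Qed.

(** This is nabla~ R = 0. *)
Lemma curvature_derivative x u v w : O x ->
  nabla_end2 C (curvature C) u x v w =
  S x u *m curvature C x v w - curvature C x v w *m S x u
  - curvature C x (S x u *m v) w - curvature C x v (S x u *m w).
Proof.
move=> Ox; have Csub y (a b : 'cV[R]_m) : O y -> C y (a - b) = C y a - C y b.
  exact: (connection_sub openO smoothG symG unitG).
have Kl (a b c : 'cV[R]_m) : curvature C x (a - b) c = curvature C x a c - curvature C x b c.
  exact: (curvature_subl openO smoothC a b c Csub Ox).
have Kr (a b c : 'cV[R]_m) : curvature C x c (a - b) = curvature C x c a - curvature C x c b.
  rewrite curvature_anti Kl [curvature C x c a]curvature_anti.
  by rewrite [curvature C x c b]curvature_anti opprK opprB addrC.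
have := parallelR Ox u v w; rewrite /nabla_end2 /nabla_end; cbv beta.
rewrite [(C x u - S x u) *m v]mulmxBl [(C x u - S x u) *m w]mulmxBl Kl Kr.
have e (d c s K k1 k2 k3 k4 : 'M[R]_m) : d + (c - s) *m K - K *m (c - s) - (k1 - k2) - (k3 - k4) = 0 ->
  d + c *m K - K *m c - k1 - k3 = s *m K - K *m s - k2 - k4.
  by move=> h; rewrite -[LHS]subr0 -h; mx_ring.
exact: e.
Qed.

Lemma frame_flat x u v : O x -> curvature C x u v = 0.
Proof.
move=> Ox.
pose ip := pairing (G x).
pose k a b c d := ip (curvature C x a b *m c) d.
have ipC y z : ip y z = ip z y by apply: pairingC; apply: symG.
have q := frame_triple Ox.
have ip_lin a y z w : ip (a *: y + z) w = a * ip y w + ip z w by apply: pairing_lin.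
have ipN y z : ip (- y) z = - ip y z by rewrite !(ipC _ z) /ip pairingNr.
have ipD y z w : ip (y + z) w = ip y w + ip z w by rewrite !(ipC _ w) /ip pairingDr.
have ip0 z : ip 0 z = 0 by have := ipD 0 0 z; rewrite addr0; lra.
have k12 a b c d : k a b c d = - k b a c d.
  by rewrite /k curvature_anti mxNl ipN.
have k34 a b c d : k a b c d = - k a b d c.
  rewrite /k [X in _ = - X]ipC /ip pairing_skew //.
  apply/eqP; rewrite -subr_eq0 opprK; apply/eqP.
  exact: (curvature_skew openO smoothC a b smoothG (fun y w Oy => metric w Oy) Ox).
have k_bianchi a b c d : k a b c d + k b c a d + k c a b d = 0.
  by rewrite /k -!ipD (first_bianchi openO smoothC torsionfree).
have k_lin a b t c c' d : k a b (t *: c + c') d = t * k a b c d + k a b c' d.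
  by rewrite /k mxDr mxZr; apply: ip_lin.
have k_xi a b d : k a b (xi x) d = 0 by rewrite /k curvature_xi.
have [w xw] := pairing_neq0 (symG Ox) (unitG Ox) (xi_neq0 Ox).
have [X0 dX0] := dual_exists ipC ip_lin q xw.
have /choice [r rE] := fun p : 'cV[R]_m * 'cV[R]_m => curvature_commutator p.1 p.2 Ox.
have s : sp1_part ip k (mulmx (J 0 x)) (mulmx (J 1 x)) (mulmx (J 2 x))
    (fun a b => (r (a, b)).1.1) (fun a b => (r (a, b)).1.2) (fun a b => (r (a, b)).2).
  move=> a b c d; have [h0 h1 h2] := rE (a, b).
  have comm i M : curvature C x a b *m J i x - J i x *m curvature C x a b = M ->
      k a b (J i x *m c) d + k a b c (J i x *m d) = ip (M *m c) d.
    have sk y z : ip (J i x *m y) z = - ip y (J i x *m z).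
      by apply: pairing_skew; apply: skewJ.
    by move=> <-; rewrite mxDl mxNl !mxA ipD ipN sk opprK.
  have ipZ t y z : ip (t *: y) z = t * ip y z.
    by rewrite -[_ *: y]addr0 ip_lin ip0 addr0.
  rewrite (comm _ _ h0) (comm _ _ h1) (comm _ _ h2) /=.
  by rewrite !mx_expand !ipD !ipN !ipZ.
suff k0 : forall a b c d, k a b c d = 0.
  apply/matrixP => i j.
  have : curvature C x u v *m (delta_mx j 0 : 'cV[R]_m) = 0.
    by apply: (pairing_eq0 (symG Ox) (unitG Ox)) => z; apply: k0.
  move=> /(congr1 (fun A : 'cV[R]_m => A i 0)).
  by rewrite -(colE j (curvature C x u v)) [X in X = _]mxE => ->; rewrite !mxE.
apply: (curvature_zero ipC ip_lin k12 k34 k_bianchi _ (xi_null Ox) k_xi q s dX0) => //.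
move=> D a b c d e.
have SE y z : linear_type ip (xi x) (mulmx (J 0 x)) (mulmx (J 1 x)) (mulmx (J 2 x)) y z
   = S x y *m z by rewrite S_expand.
have DE a' b' c' : D a' b' c' d e =
  - ip (nabla_end2 C (curvature C) a' x b' c' *m d) e.
  have split4 (A1 A2 A3 A4 : 'M[R]_m) :
      (A1 - A2 - A3 - A4) *m d = A1 *m d - A2 *m d - A3 *m d - A4 *m d.
    by rewrite !mulmxBl.
  rewrite /D !SE curvature_derivative // split4 !ipD !ipN !mxA.
  have sk y z : ip (S x a' *m y) z = - ip y (S x a' *m z).
    by apply: pairing_skew; apply: metric_S.
  rewrite sk.
  by rewrite -!opprD opprK.
rewrite !DE -!opprD -!ipD -!mxDl (second_bianchi openO smoothC torsionfree a b c Ox).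
by rewrite mul0mx ip0 oppr0.
Qed.
End Frame.


Theorem proposition6p7 (R : realType) (n : nat) (M : manifold R (4 * n)%N)
    (g : chart M -> 'cV[R]_(4 * n) -> 'M[R]_(4 * n))
    (Q : chart M -> 'cV[R]_(4 * n) -> set 'M[R]_(4 * n)) :
  (8 <= 4 * n)%N ->
  pseudo_quaternion_kahler g Q ->
  (exists S : chart M -> 'cV[R]_(4 * n) -> 'cV[R]_(4 * n) -> 'M[R]_(4 * n),
      homogeneous_pqk g Q S /\ strongly_degenerate_linear_type g Q S) ->
  flat g.
Proof.
move=> n8 [[[smooth_g sym_g _ _] skewQ _ _] parQ] [S [homS degS]].
case: homS => [[smoothS linS _] metricS parR parS _] c x cx.
have [V [J [xi [zeta [Vx [frameJ smooth_xi _ S_def] deg]]]]] := degS c x cx.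
case: frameJ => openV Vcod smoothJ quatJ u v.
have restr (W : normedModType R) (f : 'cV[R]_(4 * n) -> W) :
    smooth_on (cod c) f -> smooth_on V f.
  by move=> sf k; apply: Ck_subset (sf k).
apply: (@frame_flat R (4 * n)%N V (g c) J xi (S c)) => //.
- exact: leq_trans n8.
- exact: restr.
- by move=> y /Vcod /sym_g [].
- by move=> y /Vcod /sym_g [].
- by move=> y /quatJ [].
- move=> y Vy a; apply: skewQ; first exact: Vcod.
  have [_ ->] := quatJ y Vy; exists (fun b => (b == a)%:R).
  rewrite (bigD1 a) //= eqxx scale1r big1 ?addr0 // => b /negPf ->.
  by rewrite scale0r.
- move=> A sA spA y Vy w; have [_ <-] := quatJ y Vy.
  by apply: (parQ c V A) => // z Vz; have [_ ->] := quatJ z Vz; apply: spA.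
- by move=> w; apply: restr.
- by move=> y /Vcod; apply: linS.
- by move=> y /deg [].
- by move=> y /deg [].
- move=> y Vy a b; rewrite S_def //.
  by rewrite (_ : (fun a => zeta a y) = fun=> 0) //; apply/funext; have [] := deg y Vy.
- by move=> y /Vcod; apply: metricS.
- by move=> y /Vcod; apply: parR.
- by move=> y /Vcod; apply: parS.
Qed.
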